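(* Let $\Omega=\mathbb{FP}^{d-1}$ be a projective space of real dimension $D$. If $0<s<D$, then there is a constant $C_{s,D}>0$ such that for every $N$ and every $N$-point configuration $\omega_N\subset\Omega$ $$E_{K_s}(\omega_N)\ge I_{K_s}(\sigma)N^2-C_{s,D}N^{1+\frac sD}.$$ For $s=0$ there is a constant $C_{0,D}>0$ such that for every $N$ and every $N$-point configuration $\omega_N\subset\Omega$ $$E_{K_0}(\omega_N)\ge I_{K_0}(\sigma)N^2-\frac1D N\log N-C_{0,D}N.$$
   Context: Projective spaces: $\mathbb{F}\in\{\mathbb{R},\mathbb{C},\mathbb{H},\mathbb{O}\}$, $d\ge 3$ an integer, with $d=3$ when $\mathbb{F}=\mathbb{O}$. $\Omega=\mathbb{FP}^{d-1}$ may be realized as the set of Hermitian $d\times d$ matrices $\Pi$ over $\mathbb{F}$ with $\Pi^2=\Pi$ and $\mathrm{Tr}(\Pi)=1$. It carries its isometry-invariant Riemannian metric, normalized so that the geodesic distance $\vartheta$ takes values in $[0,\frac{\pi}{2}]$ (diameter $\frac\pi2$). The chordal metric is $\rho(x,y)=\sin(\vartheta(x,y))$; in the matrix model $\rho(\Pi_1,\Pi_2)=\sqrt{1-\langle\Pi_1,\Pi_2\rangle}$ with $\langle A,B\rangle=\mathrm{Re}\sum_{i,j}a_{ij}\overline{b_{ij}}$. $\sigma$ is the isometry-invariant Borel probability measure. $D=(d-1)\dim_{\mathbb{R}}(\mathbb{F})$. $K_s(x,y)=\rho(x,y)^{-s}$ for $s>0$; $K_0(x,y)=-\log\rho(x,y)$.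 $I_K(\mu)=\iint K\,d\mu\,d\mu$; $E_K(\omega_N)=\sum_{i\ne j}K(x_i,x_j)$ for $\omega_N=\{x_1,\dots,x_N\}$. *)

(* Defs.v *)
(* MathComp-Analysis; real scalars are an arbitrary R : realType *)
From HB Require Import structures.
From mathcomp Require Import all_boot all_order all_algebra.
From mathcomp Require Import all_classical all_reals all_analysis.
Set Implicit Arguments.
Unset Strict Implicit.
Unset Printing Implicit Defensive.
Import Order.TTheory GRing.Theory Num.Theory.
Import numFieldNormedType.Exports.
Local Open Scope classical_set_scope.
Local Open Scope ring_scope.

(* The Cayley-Dickson doubling over R: cd R 0, ..., cd R 3 are the real
   algebras R, C, H, O with their Euclidean topology. The algebra product is
   cd_mul, not the componentwise product that MathComp puts on pairs; it is
   not associative for n = 3, so matrix products are written out below. *)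
Fixpoint cd (R : realType) (n : nat) : normedModType R :=
  if n is m.+1 then (cd R m * cd R m)%type : normedModType R
  else R^o : normedModType R.

Fixpoint cd_one (R : realType) (n : nat) : cd R n :=
  match n return cd R n with
  | 0 => 1 : R
  | m.+1 => (cd_one R m, 0)
  end.

Fixpoint cd_Re (R : realType) (n : nat) : cd R n -> R :=
  match n return cd R n -> R with
  | 0 => fun x => x
  | m.+1 => fun x => cd_Re x.1
  end.

Fixpoint cd_conj (R : realType) (n : nat) : cd R n -> cd R n :=
  match n return cd R n -> cd R n with
  | 0 => fun x => x
  | m.+1 => fun x => (cd_conj x.1, - x.2)
  end.

Fixpoint cd_mul (R : realType) (n : nat) : cd R n -> cd R n -> cd R n :=
  match n return cd R n -> cd R n -> cd R n with
  | 0 => fun x y => (x : R) * (y : R)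
  | m.+1 => fun x y =>
      (cd_mul x.1 y.1 - cd_mul (cd_conj y.2) x.2,
       cd_mul y.2 x.1 + cd_mul x.2 (cd_conj y.1))
  end.

Inductive scalars := Reals | Complexes | Quaternions | Octonions.

Definition cd_level (F : scalars) : nat :=
  match F with Reals => 0 | Complexes => 1 | Quaternions => 2 | Octonions => 3
  end.

Notation scalar_alg R F := (cd R (cd_level F)).

Definition dim_scalars (F : scalars) : nat :=
  match F with Reals => 1 | Complexes => 2 | Quaternions => 4 | Octonions => 8
  end.

Definition is_projector (R : realType) (F : scalars) (d : nat)
    (A : 'M[scalar_alg R F]_d) : bool :=
  [&& [forall i, forall j, A i j == cd_conj (A j i)],
      [forall i, forall j, \sum_k cd_mul (A i k) (A k j) == A i j]
    & \sum_i A i i == cd_one R (cd_level F)].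

(* FP R F n is the projective n-space, made of matrices of size d = n + 1. *)
Record FP (R : realType) (F : scalars) (n : nat) := MkFP {
  FP_mx :> 'M[scalar_alg R F]_n.+1 ;
  FP_mxP : is_projector FP_mx }.

HB.instance Definition _ (R : realType) (F : scalars) (n : nat) :=
  [isSub of FP R F n for @FP_mx R F n].
HB.instance Definition _ (R : realType) (F : scalars) (n : nat) :=
  [Choice of FP R F n by <:].

Section base_point.
Variable R : realType.

Lemma cd_conj0 n : @cd_conj R n 0 = 0.
Proof. by elim: n => //= n ->; rewrite oppr0. Qed.

Lemma cd_conj1 n : cd_conj (cd_one R n) = cd_one R n.
Proof. by elim: n => //= n ->; rewrite oppr0. Qed.

Lemma cd_mul0 n (x : cd R n) : cd_mul 0 x = 0 /\ cd_mul x 0 = 0.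
Proof.
elim: n x => [|n IH] x /=; first by rewrite mul0r mulr0.
rewrite cd_conj0; have [e1 e2] := (IH x.1, IH x.2).
have [f1 f2] := (IH (cd_conj x.1), IH (cd_conj x.2)).
split; congr pair; rewrite ?e1.1 ?f2.2 ?e2.2 ?f1.1 ?e1.2 ?e2.1 ?subr0 ?addr0 //.
Qed.

Lemma cd_mul11 n : cd_mul (cd_one R n) (cd_one R n) = cd_one R n.
Proof.
elim: n => [|n IH] /=; first by rewrite mulr1.
by rewrite IH (cd_mul0 _).2 !(cd_mul0 _).1 subr0 addr0.
Qed.

Lemma base_pointP (F : scalars) n :
  is_projector (\matrix_(i < n.+1, j < n.+1)
    if (i == ord0) && (j == ord0) then cd_one R (cd_level F) else 0).
Proof.
apply/and3P; split.
- apply/forallP => i; apply/forallP => j; rewrite !mxE andbC.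
  by case: ifP; rewrite ?cd_conj1 ?cd_conj0.
- apply/forallP => i; apply/forallP => j.
  rewrite (bigD1 ord0)//= big1 ?addr0 => [|k /negbTE k0]; rewrite !mxE.
    rewrite eqxx andbT; case: (i == ord0) => /=; last by rewrite (cd_mul0 _).1.
    by case: (j == ord0); rewrite ?cd_mul11 ?(cd_mul0 _).2.
  by rewrite k0 andbF (cd_mul0 _).1.
- rewrite (bigD1 ord0)//= big1 ?addr0 => [|k /negbTE k0]; rewrite !mxE ?eqxx//.
  by rewrite k0.
Qed.

End base_point.

HB.instance Definition _ (R : realType) (F : scalars) (n : nat) :=
  isPointed.Build (FP R F n) (MkFP (base_pointP R F n)).

(* Topology induced from the space of matrices, which is also that of the
   chordal and geodesic distances, and its Borel sigma-algebra. *)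
HB.instance Definition _ (R : realType) (F : scalars) (n : nat) :=
  Topological.copy (FP R F n) (initial_topology (@FP_mx R F n)).
HB.instance Definition _ (R : realType) (F : scalars) (n : nat) :=
  Measurable.copy (FP R F n) (g_sigma_algebraType (@open (FP R F n))).

Section projective_space.
Variables (R : realType) (F : scalars) (n : nat).
Implicit Types x y : FP R F n.

(* <A, B> = Re \sum_(i, j) a_ij b_ij^* *)
Definition mx_inner (A B : 'M[scalar_alg R F]_n.+1) : R :=
  cd_Re (\sum_i \sum_j cd_mul (A i j) (cd_conj (B i j))).

Definition chordal x y : R := Num.sqrt (1 - mx_inner x y).

(* Inverse to rho = sin theta, as theta ranges over [0, pi / 2]. *)
Definition geodesic x y : R := asin (chordal x y).

Definition is_isometry (f : FP R F n -> FP R F n) : Prop :=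
  bijective f /\ forall x y, geodesic (f x) (f y) = geodesic x y.

(* Isometries act transitively on the compact space FP R F n, so exactly one
   Borel probability measure satisfies this. *)
Definition isometry_invariant (sigma : probability (FP R F n) R) : Prop :=
  forall f, is_isometry f ->
  forall A : set (FP R F n), measurable A -> sigma (f @^-1` A) = sigma A.

Local Open Scope ereal_scope.

(* rho `^ (- s) would be 0 at rho = 0, whence the explicit value +oo. *)
Definition riesz (s : R) x y : \bar R :=
  if chordal x y == 0%R then +oo else (chordal x y `^ (- s))%:E.

(* lne 0 = -oo, hence the value +oo on the diagonal. *)
Definition log_kernel x y : \bar R := - lne (chordal x y)%:E.

Definition energy_integral (mu : probability (FP R F n) R)
    (K : FP R F n -> FP R F n -> \bar R) : \bar R :=
  \int[mu]_x \int[mu]_y K x y.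

Definition discrete_energy (K : FP R F n -> FP R F n -> \bar R)
    (N : nat) (w : 'I_N -> FP R F n) : \bar R :=
  \sum_(i < N) \sum_(j < N | j != i) K (w i) (w j).

End projective_space.

Arguments riesz {R F n} s x y.
Arguments log_kernel {R F n} x y.

Definition dim_FP (F : scalars) (n : nat) : nat := (n * dim_scalars F)%N.

(* Main.v *)
Require Import Defs.
From HB Require Import structures.
From mathcomp Require Import all_boot all_order all_fingroup all_algebra.
From mathcomp Require Import all_classical all_reals all_analysis.
From mathcomp Require Import measurable_realfun.
From mathcomp Require Import ring lra zify.
Set Implicit Arguments.
Unset Strict Implicit.
Unset Printing Implicit Defensive.
Import Order.TTheory GRing.Theory Num.Theory.
Import numFieldNormedType.Exports.
Local Open Scope classical_set_scope.
Local Open Scope ring_scope.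

(** Both kernels are power series with nonnegative coefficients in the overlap
    t = <x, y> = 1 - rho(x, y)^2, which lies in [0, 1]: the Riesz kernel is
    (1 - t)^(-s/2), the logarithmic one is - ln(1 - t) / 2. Powers of an inner
    product are positive definite, so truncating the series at degree T gives a
    positive definite kernel that stays below K and is finite on the diagonal.

    Write a_k for the coefficients and M_k for the mean of t^k. Invariance of
    sigma and transitivity of the isometry group (FP_transitive) make the
    potential of sigma for t^k constant, equal to M_k (momentE). Positive
    definiteness then says that the sum of t^k over all pairs of N points is at
    least N^2 M_k (mean_energy_le). Summing over k < T and removing the diagonal,
    the energy is at least N^2 sum_(k < T) a_k M_k - N sum_(k < T) a_k
    (discrete_energy_ge), while I_K(sigma) is the full sum of a_k M_k. So the
    statement reduces to three estimates with p = s/2, and p = 0 for the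
    logarithm: a_k = O(k^(p - 1)); the partial sums of a_k are O(T^p), or at most
    (1 + ln T)/2; and M_k = O(k^(-D/2)). With T of order N^(2/D) the tail
    N^2 T^(p - D/2) and the diagonal N T^p both have order N^(1 + s/D), and the
    diagonal of the logarithmic kernel contributes (1/D) N ln N.

    The bound on M_k (moment_le) comes from the same inequality
    N^2 M_k <= sum of t^k, used in the other direction: it is tested on a lattice
    of k^(D/2) points in an affine chart, for which the sum is easily bounded.

    Transitivity is proved by bringing every projector to the base point. If one
    row is real, a real orthogonal conjugation does it, over all four algebras
    (congruent_real_row). A row is made real by a diagonal unitary conjugation in
    the associative case, and over the octonions by the maps that multiply the
    three off-diagonal entries by a unit on the left, on the right and on both
    sides; these are compatible with the product by the Moufang identities. *)

(** * Cayley-Dickson doublings *)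
Section algebra.
Variable R : realType.

Lemma cd_pairD n (x y : cd R n.+1) : x + y = (x.1 + y.1, x.2 + y.2).
Proof. by []. Qed.
Lemma cd_pairZ n (a : R) (x : cd R n.+1) : a *: x = (a *: x.1, a *: x.2).
Proof. by []. Qed.

Lemma cd_conjD n (x y : cd R n) : cd_conj (x + y) = cd_conj x + cd_conj y.
Proof. by elim: n x y => //= n IH x y; rewrite IH opprD. Qed.
Lemma cd_conjZ n (a : R) (x : cd R n) : cd_conj (a *: x) = a *: cd_conj x.
Proof. by elim: n x => //= n IH x; rewrite IH cd_pairZ /= scalerN. Qed.
Lemma cd_conjK n (x : cd R n) : cd_conj (cd_conj x) = x.
Proof. by elim: n x => //= n IH [x y] /=; rewrite IH opprK. Qed.
Lemma cd_conjN n (x : cd R n) : cd_conj (- x) = - cd_conj x.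
Proof. by rewrite -scaleN1r cd_conjZ scaleN1r. Qed.
Lemma cd_ReD n (x y : cd R n) : cd_Re (x + y) = cd_Re x + cd_Re y.
Proof. by elim: n x y => //= n IH x y; rewrite IH. Qed.
Lemma cd_ReZ n (a : R) (x : cd R n) : cd_Re (a *: x) = a * cd_Re x.
Proof. by elim: n x => //= n IH x; rewrite IH. Qed.
Lemma cd_Re0 n : cd_Re (0 : cd R n) = 0.
Proof. by rewrite -[X in cd_Re X](scale0r (0 : cd R n)) cd_ReZ mul0r. Qed.
Lemma cd_ReN n (x : cd R n) : cd_Re (- x) = - cd_Re x.
Proof. by rewrite -scaleN1r cd_ReZ mulN1r. Qed.
Lemma cd_Re_sum n I (r : seq I) (P : pred I) (f : I -> cd R n) :
  cd_Re (\sum_(i <- r | P i) f i) = \sum_(i <- r | P i) cd_Re (f i).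
Proof. exact: (big_morph _ (@cd_ReD n) (cd_Re0 n)). Qed.
Lemma cd_Re1 n : cd_Re (cd_one R n) = 1.
Proof. by elim: n. Qed.
Lemma cd_ReJ n (x : cd R n) : cd_Re (cd_conj x) = cd_Re x.
Proof. by elim: n x => //= n IH x; rewrite IH. Qed.

(** Each step of the doubling conjugates and swaps factors, so left and right
    laws refer to each other one level down; they are proved by a mutual
    recursion. *)
Lemma cd_mulDl n (x y z : cd R n) : cd_mul (x + y) z = cd_mul x z + cd_mul y z
with cd_mulDr n (x y z : cd R n) : cd_mul z (x + y) = cd_mul z x + cd_mul z y.
Proof.
- case: n x y z => [|n] x y z /=; first by rewrite mulrDl.
  rewrite !cd_mulDr !cd_mulDl cd_pairD /=; congr pair; first by rewrite opprD addrACA.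
  by rewrite addrACA.
- case: n x y z => [|n] x y z /=; first by rewrite mulrDr.
  rewrite !cd_conjD !cd_mulDr !cd_mulDl cd_pairD /=; congr pair.
    by rewrite opprD addrACA.
  by rewrite addrACA.
Qed.

Lemma cd_mulZl n a (x y : cd R n) : cd_mul (a *: x) y = a *: cd_mul x y
with cd_mulZr n a (x y : cd R n) : cd_mul x (a *: y) = a *: cd_mul x y.
Proof.
- case: n x y => [|n] x y /=; first by rewrite -mulrA.
  by rewrite cd_pairZ /= !cd_mulZl !cd_mulZr scalerBr scalerDr.
- case: n x y => [|n] x y /=; first by rewrite mulrCA.
  by rewrite cd_pairZ /= !cd_conjZ !cd_mulZl !cd_mulZr scalerBr scalerDr.
Qed.

Lemma cd_mulNl n (x y : cd R n) : cd_mul (- x) y = - cd_mul x y.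
Proof. by rewrite -scaleN1r cd_mulZl scaleN1r. Qed.
Lemma cd_mulNr n (x y : cd R n) : cd_mul x (- y) = - cd_mul x y.
Proof. by rewrite -scaleN1r cd_mulZr scaleN1r. Qed.
Lemma cd_mul0l n (x : cd R n) : cd_mul 0 x = 0. Proof. exact: (cd_mul0 x).1. Qed.
Lemma cd_mul0r n (x : cd R n) : cd_mul x 0 = 0. Proof. exact: (cd_mul0 x).2. Qed.
Lemma cd_mul_suml n I (r : seq I) (P : pred I) (f : I -> cd R n) y :
  cd_mul (\sum_(i <- r | P i) f i) y = \sum_(i <- r | P i) cd_mul (f i) y.
Proof.
apply: (big_morph (fun x => cd_mul x y)) => [u v|]; [exact: cd_mulDl|exact: cd_mul0l].
Qed.
Lemma cd_mul_sumr n I (r : seq I) (P : pred I) (f : I -> cd R n) y :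
  cd_mul y (\sum_(i <- r | P i) f i) = \sum_(i <- r | P i) cd_mul y (f i).
Proof.
apply: (big_morph (cd_mul y)) => [u v|]; [exact: cd_mulDr|exact: cd_mul0r].
Qed.

Lemma cd_mul1l n (x : cd R n) : cd_mul (cd_one R n) x = x
with cd_mul1r n (x : cd R n) : cd_mul x (cd_one R n) = x.
Proof.
- case: n x => [|n] x /=; first by rewrite mul1r.
  by rewrite cd_mul1l cd_mul1r cd_mul0r cd_mul0l subr0 addr0; case: x.
- case: n x => [|n] x /=; first by rewrite mulr1.
  by rewrite cd_mul1r cd_conj1 cd_mul1r cd_conj0 !cd_mul0l subr0 add0r; case: x.
Qed.

Lemma cd_conjM n (x y : cd R n) :
  cd_conj (cd_mul x y) = cd_mul (cd_conj y) (cd_conj x).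
Proof.
elim: n x y => [|n IH] x y /=; first by rewrite mulrC.
rewrite !cd_conjD !cd_conjN !IH !cd_conjK !cd_mulNr !cd_mulNl; congr pair.
  by rewrite opprK.
by rewrite opprD addrC.
Qed.

Lemma cd_ReMC n (x y : cd R n) : cd_Re (cd_mul x y) = cd_Re (cd_mul y x).
Proof.
elim: n x y => [|n IH] x y /=; first by rewrite mulrC.
rewrite !cd_ReD !cd_ReN IH; congr (_ - _).
by rewrite -[LHS]cd_ReJ cd_conjM cd_conjK.
Qed.

(** The Euclidean inner product, as the trace form of the algebra. *)
Definition cd_dot n (x y : cd R n) : R := cd_Re (cd_mul x (cd_conj y)).

(** Doubling is an orthogonal sum: the cross term is moved back to Euclidean
    form by the symmetry of the real part of a product. *)
Lemma cd_dotS n (x y : cd R n.+1) :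
  cd_dot x y = cd_dot x.1 y.1 + cd_dot x.2 y.2.
Proof.
by rewrite /cd_dot /= cd_ReD cd_ReN cd_conjN cd_mulNl cd_ReN opprK (cd_ReMC (cd_conj _)).
Qed.

Lemma cd_dotC n (x y : cd R n) : cd_dot x y = cd_dot y x.
Proof. by rewrite /cd_dot -cd_ReJ cd_conjM cd_conjK. Qed.
Lemma cd_dotDl n (x y z : cd R n) : cd_dot (x + y) z = cd_dot x z + cd_dot y z.
Proof. by rewrite /cd_dot cd_mulDl cd_ReD. Qed.
Lemma cd_dotZl n a (x z : cd R n) : cd_dot (a *: x) z = a * cd_dot x z.
Proof. by rewrite /cd_dot cd_mulZl cd_ReZ. Qed.
Lemma cd_dotDr n (x y z : cd R n) : cd_dot z (x + y) = cd_dot z x + cd_dot z y.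
Proof. by rewrite cd_dotC cd_dotDl !(cd_dotC z). Qed.
Lemma cd_dotZr n a (x z : cd R n) : cd_dot z (a *: x) = a * cd_dot z x.
Proof. by rewrite cd_dotC cd_dotZl (cd_dotC z). Qed.
Lemma cd_dotNl n (x z : cd R n) : cd_dot (- x) z = - cd_dot x z.
Proof. by rewrite -scaleN1r cd_dotZl mulN1r. Qed.
Lemma cd_dotNr n (x z : cd R n) : cd_dot z (- x) = - cd_dot z x.
Proof. by rewrite -scaleN1r cd_dotZr mulN1r. Qed.
Lemma cd_dotJ n (x y : cd R n) : cd_dot (cd_conj x) (cd_conj y) = cd_dot x y.
Proof. by rewrite /cd_dot cd_conjK cd_ReMC -cd_ReJ cd_conjM cd_conjK. Qed.

Lemma cd_dot_ge0 n (x : cd R n) : 0 <= cd_dot x x.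
Proof.
elim: n x => [|n IH] x; first by rewrite /cd_dot /= -expr2 sqr_ge0.
by rewrite cd_dotS addr_ge0.
Qed.
Lemma cd_dot_eq0 n (x : cd R n) : cd_dot x x = 0 -> x = 0.
Proof.
elim: n x => [|n IH] x.
  by rewrite /cd_dot /= => /eqP; rewrite mulf_eq0 orbb => /eqP.
rewrite cd_dotS => /eqP; rewrite paddr_eq0 ?cd_dot_ge0 // => /andP[/eqP h1 /eqP h2].
by case: x h1 h2 => x y /= /IH -> /IH ->.
Qed.

Lemma cd_mulJ n (x : cd R n) : cd_mul x (cd_conj x) = cd_dot x x *: cd_one R n.
Proof.
elim: n x => [|n IH] x; first by rewrite /cd_dot /= [_ *: _]mulr1.
rewrite cd_dotS cd_pairZ /= scaler0; congr pair; last first.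
  by rewrite cd_mulNl cd_conjK addrC subrr.
rewrite cd_conjN cd_mulNl opprK IH scalerDl; congr (_ + _).
by have := IH (cd_conj x.2); rewrite cd_conjK cd_dotJ.
Qed.
Lemma cd_Jmul n (x : cd R n) : cd_mul (cd_conj x) x = cd_dot x x *: cd_one R n.
Proof. by have := cd_mulJ (cd_conj x); rewrite cd_conjK cd_dotJ. Qed.

Lemma cd_addJ n (x : cd R n) : x + cd_conj x = (2 * cd_Re x) *: cd_one R n.
Proof.
elim: n x => [|n IH] x /=; first by rewrite [_ *: _]mulr1 mulr_natl mulr2n.
by rewrite cd_pairD cd_pairZ /= IH scaler0 subrr.
Qed.

Lemma cd_conj_real n (x : cd R n) : cd_conj x = x -> x = cd_Re x *: cd_one R n.
Proof.
move=> h; have := cd_addJ x; rewrite h -scalerA -mulr2n -scaler_nat.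
by move/(scalerI (lt0r_neq0 (ltr0Sn R 1))).
Qed.

Lemma cd_mul_realr n a (x : cd R n) : cd_mul x (a *: cd_one R n) = a *: x.
Proof. by rewrite cd_mulZr cd_mul1r. Qed.
Lemma cd_mul_reall n a (x : cd R n) : cd_mul (a *: cd_one R n) x = a *: x.
Proof. by rewrite cd_mulZl cd_mul1l. Qed.

Lemma cd_mulA n (x y z : cd R n) : (n <= 2)%N ->
  cd_mul x (cd_mul y z) = cd_mul (cd_mul x y) z.
Proof.
case: n x y z => [|[|[|//]]] x y z _ /=; first by rewrite mulrA.
  by congr pair; ring.
by congr (pair (pair _ _) (pair _ _)); rewrite /=; ring.
Qed.
End algebra.

(** * Alternative and Moufang laws *)
Section algebra.
Variable R : realType.

(** This holds at every level, even where the product is not associative: once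
    both sides are expanded they have the same four terms up to cyclic
    permutations, which the induction hypothesis allows under the real part.
    *)
Lemma cd_ReMA n (x y z : cd R n) :
  cd_Re (cd_mul (cd_mul x y) z) = cd_Re (cd_mul x (cd_mul y z)).
Proof.
elim: n x y z => [|n IH]; first by move=> x y z; rewrite /= mulrA.
have cyc (a b c : cd R n) :
    cd_Re (cd_mul a (cd_mul b c)) = cd_Re (cd_mul b (cd_mul c a)).
  by rewrite -[RHS]IH [LHS]cd_ReMC IH cd_ReMC IH.
move=> [a b] [c d] [e f] /=.
rewrite ?(cd_conjD, cd_conjN, cd_conjM, cd_conjK, cd_mulDl, cd_mulDr, cd_mulNl, cd_mulNr).
rewrite !(cd_ReD, cd_ReN) !IH.
rewrite (cyc (cd_conj d) b e) (cyc b e (cd_conj d)) (cyc (cd_conj f) d a).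
rewrite (cyc d a (cd_conj f)) (cyc (cd_conj f) b (cd_conj c)).
rewrite (cyc b (cd_conj c) (cd_conj f)).
ring.
Qed.

(** Doubling an associative algebra yields an alternative one: in the two
    components of the product all terms but the norms cancel, using
    associativity one level below. *)
Lemma cd_mulJK n (x y : cd R n) : (n <= 3)%N ->
  cd_mul (cd_conj x) (cd_mul x y) = cd_dot x x *: y.
Proof.
case: n x y => [|n]; first by move=> x y _; rewrite /cd_dot /= mulrA.
move=> [a b] [c d] n2; have A := fun u v w : cd R n => cd_mulA u v w n2.
rewrite cd_dotS cd_pairZ /= ?(cd_conjD, cd_conjN, cd_conjM, cd_conjK).
rewrite !(cd_mulDl, cd_mulDr, cd_mulNl, cd_mulNr) !A cd_Jmul cd_mul_reall.
rewrite -!A cd_Jmul cd_mulJ cd_mul_realr !scalerDl; congr pair.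
  by rewrite opprD !opprK addrA subrK.
by rewrite cd_mul_realr opprK addrA addrK A cd_mulJ cd_mul_reall.
Qed.

Lemma cd_mulKJ n (x y : cd R n) : (n <= 3)%N ->
  cd_mul (cd_mul y x) (cd_conj x) = cd_dot x x *: y.
Proof.
move=> n3; apply: (can_inj (@cd_conjK R n)).
by rewrite 2!cd_conjM (cd_mulJK (cd_conj x)) // cd_dotJ cd_conjZ.
Qed.

(** Composition law, polarized: push u across the inner product with the
    associativity of the real part, then cancel it against its conjugate. *)
Lemma cd_dotMl n (u a b : cd R n) : (n <= 3)%N ->
  cd_dot (cd_mul u a) (cd_mul u b) = cd_dot u u * cd_dot a b.
Proof.
move=> n3; rewrite cd_dotC {1}/cd_dot cd_conjM cd_ReMC cd_ReMA.
by rewrite cd_mulJK // cd_mulZr cd_ReZ (cd_ReMC (cd_conj a))  -/(cd_dot b a) (cd_dotC b).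
Qed.
Lemma cd_dotMr n (u a b : cd R n) : (n <= 3)%N ->
  cd_dot (cd_mul a u) (cd_mul b u) = cd_dot u u * cd_dot a b.
Proof.
by move=> n3; rewrite -cd_dotJ !cd_conjM cd_dotMl // !cd_dotJ.
Qed.

Definition associator n (x y z : cd R n) := cd_mul (cd_mul x y) z - cd_mul x (cd_mul y z).

Lemma cd_alternativel n (x y : cd R n) : (n <= 3)%N ->
  cd_mul x (cd_mul x y) = cd_mul (cd_mul x x) y.
Proof.
move=> n3; have h := cd_addJ x; have h2 : x = (2 * cd_Re x) *: cd_one R n - cd_conj x.
  by rewrite -h addrK.
rewrite {1}[in LHS]h2 {2}[in RHS]h2.
rewrite cd_mulDl cd_mulNl cd_mulJK // cd_mul_reall.
by rewrite cd_mulDr cd_mul_realr cd_mulNr cd_mulJ cd_mulDl cd_mulNl cd_mul_reall cd_mulZl.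
Qed.

Lemma cd_alternativer n (x y : cd R n) : (n <= 3)%N ->
  cd_mul (cd_mul y x) x = cd_mul y (cd_mul x x).
Proof.
by move=> n3; apply: (can_inj (@cd_conjK R n)); rewrite !cd_conjM cd_alternativel.
Qed.

Section alternative.
Variables (n : nat) (n3 : (n <= 3)%N).
Implicit Types x y z a : cd R n.
Local Notation "x ** y" := (cd_mul x y) (at level 40, left associativity).

Lemma associatorDl x x' y z : associator (x + x') y z = associator x y z + associator x' y z.
Proof. by rewrite /associator !cd_mulDl opprD addrACA. Qed.
Lemma associatorDm x x' y z : associator y (x + x') z = associator y x z + associator y x' z.
Proof. by rewrite /associator cd_mulDr !cd_mulDl cd_mulDr opprD addrACA. Qed.
Lemma associatorDr x x' y z : associator y z (x + x') = associator y z x + associator y z x'.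
Proof. by rewrite /associator !cd_mulDr opprD addrACA. Qed.
Lemma associator_xx x y : associator x x y = 0.
Proof. by rewrite /associator cd_alternativel // subrr. Qed.
Lemma associator_yy x y : associator y x x = 0.
Proof. by rewrite /associator cd_alternativer // subrr. Qed.
Lemma associator_swapl x y z : associator x y z = - associator y x z.
Proof.
have := associator_xx (x + y) z; rewrite !associatorDl !associatorDm !associator_xx addr0 add0r.
by move/eqP; rewrite addr_eq0 => /eqP.
Qed.
Lemma associator_swapr x y z : associator x y z = - associator x z y.
Proof.
have := associator_yy (y + z) x; rewrite !associatorDr !associatorDm !associator_yy addr0 add0r.
by rewrite addrC => /eqP; rewrite addr_eq0 => /eqP.
Qed.
Lemma associator_xyx x y : associator x y x = 0.
Proof. by rewrite associator_swapr associator_xx oppr0. Qed.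
Lemma cd_flexible x y : x ** (y ** x) = (x ** y) ** x.
Proof. by apply/esym/eqP; rewrite -subr_eq0 -/(associator x y x) associator_xyx. Qed.

(** The difference of the two sides is a sum of two associators; alternation
    turns it into an expression that is symmetrized in x and y, where only
    squares of a act on the left. *)
Lemma cd_moufangl a x y : a ** (y ** (a ** x)) = ((a ** y) ** a) ** x.
Proof.
apply/eqP; rewrite eq_sym -subr_eq0.
have -> : ((a ** y) ** a) ** x - a ** (y ** (a ** x)) =
    associator (a ** y) a x + associator a y (a ** x) by rewrite /associator addrA subrK.
rewrite associator_swapl (associator_swapr a y) -opprD oppr_eq0 /associator.
have E b : (b ** y) ** x + (b ** x) ** y = b ** (y ** x) + b ** (x ** y).
  by apply/eqP; rewrite -subr_eq0 opprD addrACA -/(associator b y x) associator_swapr addNr.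
by rewrite addrACA -opprD -cd_mulDr E !cd_alternativel // E cd_mulDr !cd_alternativel // subrr.
Qed.

Lemma cd_moufangr a x y : ((x ** a) ** y) ** a = x ** ((a ** y) ** a).
Proof.
by apply: (can_inj (@cd_conjK R n)); rewrite !cd_conjM cd_moufangl cd_flexible.
Qed.

(** Expanding with one associator reduces the middle identity to the left one
    and to the cyclic symmetry of the associator. *)
Lemma cd_moufangm u a b : (u ** a) ** (b ** u) = (u ** (a ** b)) ** u.
Proof.
rewrite -cd_flexible; apply/eqP; rewrite -subr_eq0.
have -> : (u ** a) ** (b ** u) - u ** ((a ** b) ** u) =
    associator u a (b ** u) - u ** associator a b u.
  by rewrite /associator cd_mulDr cd_mulNr opprB subrKA.
rewrite associator_swapr {1}/associator cd_flexible -cd_moufangl.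
have -> : associator a b u = associator b u a by rewrite associator_swapl associator_swapr opprK.
by rewrite /associator cd_mulDr cd_mulNr opprB subrr.
Qed.

End alternative.
End algebra.

(** * Projectors and real rotations *)
Section geometry.
Variable R : realType.

Section matrices.
Variables (m k : nat).
Implicit Types (A B : 'M[cd R k]_m) (Q P : 'M[R]_m).

Definition cd_mulmx A B : 'M[cd R k]_m := \matrix_(i, j) \sum_l cd_mul (A i l) (B l j).
Definition cd_adj A : 'M[cd R k]_m := \matrix_(i, j) cd_conj (A j i).
(** Real matrices act on both sides of a matrix over the algebra. All
    associativity laws hold for these actions because real scalars are
    central, which is what makes the rotations below available over the
    octonions. *)
Definition real_lmul Q A : 'M[cd R k]_m := \matrix_(i, j) \sum_l Q i l *: A l j.
Definition real_rmul A Q : 'M[cd R k]_m := \matrix_(i, j) \sum_l Q l j *: A i l.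
Definition cd_dotmx A B : R := \sum_i \sum_j cd_dot (A i j) (B i j).

Lemma cd_conj_sum I (r : seq I) (p : pred I) (f : I -> cd R k) :
  cd_conj (\sum_(i <- r | p i) f i) = \sum_(i <- r | p i) cd_conj (f i).
Proof. by apply: big_morph; [exact: cd_conjD|exact: cd_conj0]. Qed.
Lemma cd_dot_sumr x I (r : seq I) (p : pred I) (f : I -> cd R k) :
  cd_dot x (\sum_(i <- r | p i) f i) = \sum_(i <- r | p i) cd_dot x (f i).
Proof.
apply: big_morph; [by move=> *; exact: cd_dotDr|].
by rewrite /cd_dot cd_conj0 cd_mul0r cd_Re0.
Qed.

Lemma real_lmul_mulmx Q A B : cd_mulmx (real_lmul Q A) B = real_lmul Q (cd_mulmx A B).
Proof.
apply/matrixP => i j; rewrite !mxE.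
under eq_bigr do rewrite mxE cd_mul_suml.
rewrite exchange_big; apply: eq_bigr => l _; rewrite mxE scaler_sumr.
by apply: eq_bigr => p _; rewrite cd_mulZl.
Qed.
Lemma real_rmul_mulmx Q A B : cd_mulmx A (real_rmul B Q) = real_rmul (cd_mulmx A B) Q.
Proof.
apply/matrixP => i j; rewrite !mxE.
under eq_bigr do rewrite mxE cd_mul_sumr.
rewrite exchange_big; apply: eq_bigr => l _; rewrite mxE scaler_sumr.
by apply: eq_bigr => p _; rewrite cd_mulZr.
Qed.
Lemma real_rlmul_mulmx Q A B : cd_mulmx (real_rmul A Q) B = cd_mulmx A (real_lmul Q B).
Proof.
apply/matrixP => i j; rewrite !mxE.
under eq_bigr do rewrite mxE cd_mul_suml.
rewrite exchange_big; apply: eq_bigr => l _; rewrite mxE cd_mul_sumr.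
by apply: eq_bigr => p _; rewrite cd_mulZr cd_mulZl.
Qed.
Lemma real_lmulA Q P A : real_lmul Q (real_lmul P A) = real_lmul (Q *m P) A.
Proof.
apply/matrixP => i j; rewrite !mxE.
under eq_bigr do rewrite mxE scaler_sumr.
rewrite exchange_big; apply: eq_bigr => l _; rewrite mxE scaler_suml.
by apply: eq_bigr => p _; rewrite scalerA.
Qed.
Lemma real_rmulA Q P A : real_rmul (real_rmul A Q) P = real_rmul A (Q *m P).
Proof.
apply/matrixP => i j; rewrite !mxE.
under eq_bigr do rewrite mxE scaler_sumr.
rewrite exchange_big; apply: eq_bigr => l _; rewrite mxE scaler_suml.
by apply: eq_bigr => p _; rewrite scalerA mulrC.
Qed.
Lemma real_lrmul Q P A : real_lmul Q (real_rmul A P) = real_rmul (real_lmul Q A) P.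
Proof.
apply/matrixP => i j; rewrite !mxE.
under eq_bigr do rewrite mxE scaler_sumr.
rewrite exchange_big; apply: eq_bigr => l _; rewrite mxE scaler_sumr.
by apply: eq_bigr => p _; rewrite !scalerA mulrC.
Qed.
Lemma real_lmul1 A : real_lmul 1%:M A = A.
Proof.
apply/matrixP => i j; rewrite !mxE (bigD1 i) //= big1 ?addr0 ?mxE ?eqxx ?scale1r //.
by move=> l /negbTE li; rewrite mxE eq_sym li scale0r.
Qed.
Lemma real_rmul1 A : real_rmul A 1%:M = A.
Proof.
apply/matrixP => i j; rewrite !mxE (bigD1 j) //= big1 ?addr0 ?mxE ?eqxx ?scale1r //.
by move=> l /negbTE li; rewrite mxE li scale0r.
Qed.
Lemma adj_real_lmul Q A : cd_adj (real_lmul Q A) = real_rmul (cd_adj A) Q^T.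
Proof.
apply/matrixP => i j; rewrite !mxE cd_conj_sum; apply: eq_bigr => l _.
by rewrite !mxE cd_conjZ.
Qed.
Lemma adj_real_rmul Q A : cd_adj (real_rmul A Q) = real_lmul Q^T (cd_adj A).
Proof.
apply/matrixP => i j; rewrite !mxE cd_conj_sum; apply: eq_bigr => l _.
by rewrite !mxE cd_conjZ.
Qed.
Lemma tr_real_rmul Q A : \sum_i real_rmul A Q i i = \sum_i real_lmul Q A i i.
Proof.
under eq_bigr do rewrite mxE; rewrite exchange_big.
by apply: eq_bigr => i _; rewrite mxE.
Qed.
Lemma dot_real_lmul Q A B : cd_dotmx (real_lmul Q A) B = cd_dotmx A (real_lmul Q^T B).
Proof.
rewrite /cd_dotmx exchange_big [RHS]exchange_big; apply: eq_bigr => j _.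
under eq_bigr do rewrite mxE cd_dotC cd_dot_sumr.
rewrite exchange_big; apply: eq_bigr => l _; rewrite mxE cd_dot_sumr.
by apply: eq_bigr => i _; rewrite !cd_dotZr mxE cd_dotC.
Qed.
Lemma dot_real_rmul Q A B : cd_dotmx (real_rmul A Q) B = cd_dotmx A (real_rmul B Q^T).
Proof.
apply: eq_bigr => j _.
under eq_bigr do rewrite mxE cd_dotC cd_dot_sumr.
rewrite exchange_big; apply: eq_bigr => l _; rewrite mxE cd_dot_sumr.
by apply: eq_bigr => i _; rewrite !cd_dotZr mxE cd_dotC.
Qed.

End matrices.

Section points.
Variables (F : scalars) (n : nat).
Local Notation K := (cd R (cd_level F)).
Implicit Types x y z : FP R F n.

Lemma projectorP (A : 'M[K]_n.+1) :
  reflect [/\ cd_adj A = A, cd_mulmx A A = A & \sum_i A i i = cd_one R _]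
    (is_projector A).
Proof.
apply: (iffP and3P) => -[h1 h2 h3]; split.
- by apply/matrixP => i j; rewrite mxE; move/forallP/(_ i)/forallP/(_ j)/eqP: h1.
- by apply/matrixP => i j; rewrite mxE; move/forallP/(_ i)/forallP/(_ j)/eqP: h2.
- exact/eqP.
- by apply/forallP => i; apply/forallP => j; rewrite -{1}h1 mxE.
- by apply/forallP => i; apply/forallP => j; rewrite -{3}h2 mxE.
- exact/eqP.
Qed.

Lemma FP_inj x y : (x : 'M[K]_n.+1) = y -> x = y.
Proof. exact: val_inj. Qed.

Lemma mx_innerE (A B : 'M[K]_n.+1) : mx_inner A B = cd_dotmx A B.
Proof.
rewrite /mx_inner cd_Re_sum; apply: eq_bigr => i _.
by rewrite cd_Re_sum; apply: eq_bigr.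
Qed.

Lemma FP_conj x i j : cd_conj (x i j) = x j i.
Proof. by case/projectorP: (FP_mxP x) => h _ _; rewrite -[in RHS]h mxE. Qed.
Lemma FP_idem x i j : \sum_l cd_mul (x i l) (x l j) = x i j.
Proof. by case/projectorP: (FP_mxP x) => _ h _; rewrite -[in RHS]h mxE. Qed.
Lemma FP_tr x : \sum_i x i i = cd_one R _.
Proof. by case/projectorP: (FP_mxP x). Qed.
Lemma FP_diag x i : x i i = cd_Re (x i i) *: cd_one R _.
Proof. by apply: cd_conj_real; rewrite FP_conj. Qed.
(** The diagonal entries of the equation x x = x, read with x hermitian, say
    that the squared length of a row is its diagonal entry. *)
Lemma FP_row_dot x i : \sum_j cd_dot (x i j) (x i j) = cd_Re (x i i).
Proof.
rewrite -[in RHS](FP_idem x) cd_Re_sum; apply: eq_bigr => j _.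
by rewrite /cd_dot FP_conj.
Qed.
Lemma FP_trR x : \sum_i cd_Re (x i i) = 1.
Proof. by rewrite -cd_Re_sum FP_tr cd_Re1. Qed.
Lemma FP_diag_ge0 x i : 0 <= cd_Re (x i i).
Proof. by rewrite -FP_row_dot sumr_ge0 // => j _; exact: cd_dot_ge0. Qed.
Lemma FP_diag_eq0 x i : cd_Re (x i i) = 0 -> forall j, x i j = 0.
Proof.
rewrite -FP_row_dot => h j; apply: cd_dot_eq0.
have /psumr_eq0P := h; apply => // l _; exact: cd_dot_ge0.
Qed.
Lemma inner_xx x : mx_inner x x = 1.
Proof.
rewrite mx_innerE -(FP_trR x); apply: eq_bigr => i _; exact: FP_row_dot.
Qed.
(** All points have norm one, so one minus the overlap is half a squared
    Euclidean distance. *)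
Lemma inner_dist x y :
  2 * (1 - mx_inner x y) = \sum_i \sum_j cd_dot (x i j - y i j) (x i j - y i j).
Proof.
have -> : 2 * (1 - mx_inner x y) = mx_inner x x + mx_inner y y - 2 * mx_inner x y.
  by rewrite !inner_xx; ring.
rewrite !mx_innerE mulr_sumr -big_split -sumrB; apply: eq_bigr => i _.
rewrite mulr_sumr -big_split -sumrB; apply: eq_bigr => j _ /=.
rewrite !(cd_dotDl, cd_dotDr, cd_dotNl, cd_dotNr) (cd_dotC (y i j) (x i j)).
by ring.
Qed.
Lemma inner_le1 x y : mx_inner x y <= 1.
Proof.
have : 0 <= 2 * (1 - mx_inner x y).
  rewrite inner_dist; apply: sumr_ge0 => i _; apply: sumr_ge0 => j _.
  exact: cd_dot_ge0.
by rewrite pmulr_rge0 // subr_ge0.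
Qed.

(** Isometry orbits. Preserving the inner product is asked for instead of the
    geodesic distance: it is what the constructions give, and it implies the
    other. *)
Definition congruent x y := exists f : FP R F n -> FP R F n,
  [/\ bijective f, (forall u v, mx_inner (f u) (f v) = mx_inner u v) & f x = y].

Lemma congruent_refl x : congruent x x.
Proof. by exists id; split => //; exists id. Qed.
Lemma congruent_trans x y z : congruent x y -> congruent y z -> congruent x z.
Proof.
move=> [f [bf If fx]] [g [bg Ig gy]]; exists (g \o f); split => /=.
- exact: bij_comp.
- by move=> u v; rewrite Ig If.
- by rewrite fx gy.
Qed.

Lemma congruentP (f g : 'M[K]_n.+1 -> 'M[K]_n.+1) :
  (forall x, is_projector (f x)) -> (forall x, is_projector (g x)) ->
  (forall x, g (f x) = x) -> (forall x, f (g x) = x) ->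
  (forall x y, mx_inner (f x) (f y) = mx_inner x y) ->
  forall x, exists2 y, congruent x y & y = f x :> 'M[K]_n.+1.
Proof.
move=> fP gP fK gK fI x; exists (MkFP (fP x)) => //.
exists (fun x => MkFP (fP x)); split => //.
by exists (fun x => MkFP (gP x)) => u; apply: FP_inj => /=.
Qed.

Definition rotmx (Q : 'M[R]_n.+1) (A : 'M[K]_n.+1) := real_rmul (real_lmul Q A) Q^T.

Lemma rotmxP Q x : Q *m Q^T = 1%:M -> is_projector (rotmx Q x).
Proof.
move=> QQ; have QQ' : Q^T *m Q = 1%:M by apply: mulmx1C.
case/projectorP: (FP_mxP x) => h1 h2 h3; apply/projectorP; split.
- by rewrite /rotmx adj_real_rmul adj_real_lmul trmxK h1 real_lrmul.
- rewrite /rotmx real_rlmul_mulmx -real_lrmul real_lmulA QQ' real_lmul1 real_rmul_mulmx.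
  by rewrite real_lmul_mulmx h2 real_lrmul.
- by rewrite /rotmx tr_real_rmul real_lmulA QQ' real_lmul1.
Qed.

Lemma congruent_rot Q x : Q *m Q^T = 1%:M ->
  exists2 y, congruent x y & y = rotmx Q x :> 'M[K]_n.+1.
Proof.
move=> QQ; have QQ' : Q^T *m Q = 1%:M by apply: mulmx1C.
apply: (congruentP (f := rotmx Q) (g := rotmx Q^T)) => [y|y|y|y|y z].
- exact: rotmxP.
- by apply: rotmxP; rewrite trmxK.
- by rewrite /rotmx trmxK real_lrmul real_lmulA QQ' real_lmul1 real_rmulA QQ' real_rmul1.
- by rewrite /rotmx trmxK real_lrmul real_lmulA QQ real_lmul1 real_rmulA QQ real_rmul1.
- rewrite !mx_innerE /rotmx dot_real_rmul trmxK real_rmulA QQ' real_rmul1.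
  by rewrite dot_real_lmul real_lmulA QQ' real_lmul1.
Qed.

End points.
End geometry.

(** * Moving a point by phases and rotations *)
Section transitivity.
Variable R : realType.

(** The Householder reflection exchanging w and the first basis vector e has w
    as its first row; it degenerates only when w = e. *)
Lemma orthogonal_completion n (w : 'I_n.+1 -> R) : \sum_i w i ^+ 2 = 1 ->
  exists2 Q : 'M[R]_n.+1, Q *m Q^T = 1%:M & forall j, Q ord0 j = w j.
Proof.
move=> w1.
have [w01|w01] := eqVneq (w ord0) 1.
  exists 1%:M => [|j]; first by rewrite trmx1 mul1mx.
  move: w1; rewrite (bigD1 ord0) //= w01 expr1n => /eqP.
  rewrite -subr_eq0 addrAC subrr add0r => /eqP w0; rewrite mxE.
  case: eqVneq => [<-|j0]; first by rewrite w01.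
  have /psumr_eq0P := w0 => h; apply/esym/eqP; rewrite -sqrf_eq0; apply/eqP.
  by apply: h => [i _|]; [exact: sqr_ge0|rewrite eq_sym].
pose v : 'cV[R]_n.+1 := \col_i (w i - (i == ord0)%:R).
pose c := (1 - w ord0)^-1.
have vv : v^T *m v = (2 * (1 - w ord0))%:M.
  apply/matrixP => i j; rewrite !ord1 !mxE eqxx mulr1n.
  move: w1; rewrite (bigD1 ord0) //= => w1.
  rewrite (bigD1 ord0) //= !mxE eqxx.
  under eq_bigr => l /negbTE l0 do rewrite !mxE l0 subr0 -expr2.
  rewrite (_ : \sum_(l | _) _ = 1 - w ord0 ^+ 2) /=; first by ring.
  by rewrite -w1 addrAC subrr add0r.
have w0 : 1 - w ord0 != 0 by rewrite subr_eq0 eq_sym.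
exists (1%:M - c *: (v *m v^T)) => [|j]; last first.
  rewrite !mxE big_ord1 !mxE /= /c (eq_sym j).
  by field.
have sym : (1%:M - c *: (v *m v^T))^T = 1%:M - c *: (v *m v^T).
  by rewrite linearB /= linearZ /= trmx1 trmx_mul trmxK.
rewrite sym mulmxBr mulmx1 mulmxBl mul1mx -scalemxAl -scalemxAr.
rewrite mulmxA -(mulmxA v) vv mul_mx_scalar -scalemxAl !scalerA.
have -> : c * (c * (2 * (1 - w ord0))) = c + c by rewrite /c; field.
by rewrite scalerDl opprB addrK subrK.
Qed.

Section points.
Variables (F : scalars) (n : nat).
Local Notation K := (cd R (cd_level F)).
Local Notation base := (MkFP (base_pointP R F n)).
Implicit Types x y z : FP R F n.

Lemma cd_level_le3 : (cd_level F <= 3)%N. Proof. by case: F. Qed.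

(** If the first diagonal entry is one, the trace leaves nothing for the other
    ones, and a zero diagonal entry kills its row. *)
Lemma FP_corner y : cd_Re (y ord0 ord0) = 1 -> y = base.
Proof.
move=> y1; apply: FP_inj; apply/matrixP => i j; rewrite mxE.
case: (eqVneq i ord0) => [->|i0] /=; last first.
  apply: FP_diag_eq0; have := FP_trR y; rewrite (bigD1 ord0) //= y1 => /eqP.
  rewrite -subr_eq0 addrAC subrr add0r => /eqP h.
  by have /psumr_eq0P := h; apply => // l _; exact: FP_diag_ge0.
case: (eqVneq j ord0) => [->|j0] /=; first by rewrite FP_diag y1 scale1r.
apply: cd_dot_eq0; have := FP_row_dot y ord0.
rewrite (bigD1 ord0) //= (FP_diag y) y1 scale1r {1}/cd_dot cd_conj1 cd_mul1l cd_Re1.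
move/eqP.
rewrite -subr_eq0 addrAC subrr add0r => /eqP h.
by have /psumr_eq0P := h; apply => // l _; exact: cd_dot_ge0.
Qed.

(** A real row of x with positive diagonal entry, once normalized, is a fixed
    unit vector w of x, by the equation x x = x. A rotation whose first row is
    w then brings the corner entry to one. *)
Lemma congruent_real_row x i : 0 < cd_Re (x i i) ->
  (forall j, cd_conj (x i j) = x i j) -> congruent x base.
Proof.
move=> xi0 xr; pose w j := cd_Re (x i j) / Num.sqrt (cd_Re (x i i)).
have xE j : x i j = cd_Re (x i j) *: cd_one R _ by apply: cd_conj_real.
have sq : Num.sqrt (cd_Re (x i i)) != 0 by rewrite sqrtr_eq0 -ltNge.
have row2 : \sum_j cd_Re (x i j) ^+ 2 = cd_Re (x i i).
  rewrite -FP_row_dot; apply: eq_bigr => j _.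
  rewrite /cd_dot [x i j]xE cd_conjZ cd_mulZl cd_mulZr cd_conj1 cd_mul1l.
  by rewrite !cd_ReZ cd_Re1 !mulr1.
have w1 : \sum_j w j ^+ 2 = 1.
  under eq_bigr do rewrite /w expr_div_n sqr_sqrtr ?(ltW xi0) //.
  by rewrite -mulr_suml row2 divff // gt_eqF.
have [Q QQ Qw] := orthogonal_completion w1.
have [y xy yE] := congruent_rot x QQ.
apply: congruent_trans xy _; rewrite (@FP_corner y); first exact: congruent_refl.
rewrite yE !mxE cd_Re_sum -w1; apply: eq_bigr => l _.
rewrite !mxE cd_ReZ Qw cd_Re_sum expr2; congr (_ * _).
rewrite {1}/w -(FP_idem x i l) cd_Re_sum mulr_suml; apply: eq_bigr => k _.
by rewrite cd_ReZ Qw [x i k]xE cd_mul_reall !cd_ReZ /w mulrAC.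
Qed.

(** Entrywise changes of variables that are compatible with the matrix product
    of a hermitian matrix. The product law is required only for three distinct
    indices: the remaining products in x x = x involve a real diagonal entry
    or an element times its conjugate. *)
Record phase (f : 'I_n.+1 -> 'I_n.+1 -> K -> K) : Prop := Phase {
  phaseJ : forall i j a, f i j (cd_conj a) = cd_conj (f j i a) ;
  phaseD : forall i j a b, f i j (a + b) = f i j a + f i j b ;
  phaseZ : forall i j r a, f i j (r *: a) = r *: f i j a ;
  phase_dot : forall i j a b, cd_dot (f i j a) (f i j b) = cd_dot a b ;
  phase1 : forall i, f i i (cd_one R _) = cd_one R _ ;
  phaseM : forall i l j a b, i != l -> l != j -> i != j ->
    cd_mul (f i l a) (f l j b) = f i j (cd_mul a b) }.

Definition phasemx (f : 'I_n.+1 -> 'I_n.+1 -> K -> K) (A : 'M[K]_n.+1) : 'M[K]_n.+1 :=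
  \matrix_(i, j) f i j (A i j).

Lemma phase_sum f : phase f -> forall i j I (r : seq I) (p : pred I) (a : I -> K),
  f i j (\sum_(l <- r | p l) a l) = \sum_(l <- r | p l) f i j (a l).
Proof.
move=> fP i j I r p a; apply: big_morph; first exact: phaseD.
by rewrite -(scale0r (0 : K)) phaseZ // !scale0r.
Qed.

Lemma phasemxP f x : phase f -> is_projector (phasemx f x).
Proof.
move=> fP; have diag i : f i i (x i i) = x i i.
  by rewrite FP_diag phaseZ // phase1.
apply/projectorP; split.
- by apply/matrixP => i j; rewrite !mxE -phaseJ // FP_conj.
- apply/matrixP => i j; rewrite !mxE -(FP_idem x i j) phase_sum //.
  apply: eq_bigr => l _; rewrite !mxE.
  have [<-{l}|il] := eqVneq i l.
    by rewrite diag FP_diag !cd_mul_reall phaseZ.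
  have [<-{j}|lj] := eqVneq l j.
    by rewrite diag FP_diag !cd_mul_realr phaseZ.
  have [<-{j lj}|ij] := eqVneq i j; last exact: phaseM.
  rewrite -(FP_conj x i l) phaseJ // !cd_mulJ phase_dot //.
  by rewrite phaseZ // phase1.
- by rewrite -(FP_tr x); apply: eq_bigr => i _; rewrite mxE diag.
Qed.

Lemma congruent_phase f g x : phase f -> phase g ->
  (forall i j, cancel (f i j) (g i j)) -> (forall i j, cancel (g i j) (f i j)) ->
  exists2 y, congruent x y & forall i j, y i j = f i j (x i j).
Proof.
move=> fP gP fK gK.
have h1 y : is_projector (phasemx f y) by exact: phasemxP.
have h2 y : is_projector (phasemx g y) by exact: phasemxP.
have h3 y : phasemx g (phasemx f y) = y by apply/matrixP => i j; rewrite !mxE fK.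
have h4 y : phasemx f (phasemx g y) = y by apply/matrixP => i j; rewrite !mxE gK.
have h5 y z : mx_inner (phasemx f y) (phasemx f z) = mx_inner y z.
  rewrite !mx_innerE; apply: eq_bigr => i _; apply: eq_bigr => j _.
  by rewrite !mxE phase_dot.
have [y xy yE] := congruentP h1 h2 h3 h4 h5 x.
by exists y => // i j; rewrite yE mxE.
Qed.

Lemma unit_phase (a : K) : exists u : K, [/\ cd_dot u u = 1,
  cd_conj (cd_mul a u) = cd_mul a u & cd_conj (cd_mul u a) = cd_mul u a].
Proof.
have [->|a0] := eqVneq a 0.
  exists (cd_one R _); rewrite cd_mul0l cd_mul0r cd_conj0; split => //.
  by rewrite /cd_dot cd_conj1 cd_mul1l cd_Re1.
have aa : 0 < cd_dot a a.
  rewrite lt_neqAle cd_dot_ge0 andbT eq_sym.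
  by apply: contra_neq a0 => /cd_dot_eq0.
exists ((Num.sqrt (cd_dot a a))^-1 *: cd_conj a); split.
- rewrite cd_dotZl cd_dotZr cd_dotJ mulrA -invfM -expr2 sqr_sqrtr ?ltW //.
  by rewrite mulVf // gt_eqF.
- by rewrite cd_mulZr cd_mulJ !cd_conjZ cd_conj1.
- by rewrite cd_mulZl cd_Jmul !cd_conjZ cd_conj1.
Qed.

Lemma exists_diag_gt0 x : exists i, 0 < cd_Re (x i i).
Proof.
apply/existsP; rewrite -[X in is_true X]negbK negb_exists; apply/negP => /forallP h.
have := FP_trR x; rewrite big1 => [/eqP|i _]; first by rewrite eq_sym oner_eq0.
by apply/eqP; rewrite eq_le FP_diag_ge0 andbT leNgt h.
Qed.

(** Over an associative algebra, conjugation by a diagonal matrix of unit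
    scalars makes a whole row real at once. *)
Lemma congruent_base_assoc x : (cd_level F <= 2)%N -> congruent x base.
Proof.
move=> n2; have [i xi] := exists_diag_gt0 x.
have A := fun u v w : K => cd_mulA u v w n2.
have /choice[u uP] : forall j, exists v : K, [/\ cd_dot v v = 1,
    cd_conj (cd_mul (x i j) v) = cd_mul (x i j) v & j = i -> v = cd_one R _].
  move=> j; have [->|ji] := eqVneq j i.
    exists (cd_one R _); rewrite cd_mul1r FP_conj; split => //.
    by rewrite /cd_dot cd_conj1 cd_mul1l cd_Re1.
  have [v [v1 v2 _]] := unit_phase (x i j).
  by exists v; split => // /eqP; rewrite (negbTE ji).
pose f (u : 'I_n.+1 -> K) (k l : 'I_n.+1) a := cd_mul (cd_conj (u k)) (cd_mul a (u l)).
have fP v : (forall j, cd_dot (v j) (v j) = 1) -> phase (f v).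
  move=> v1; split; rewrite /f.
  - by move=> k l a; rewrite !cd_conjM cd_conjK -A.
  - by move=> k l a b; rewrite cd_mulDl cd_mulDr.
  - by move=> k l r a; rewrite cd_mulZl cd_mulZr.
  - by move=> k l a b; rewrite cd_dotMl ?cd_level_le3 // cd_dotMr ?cd_level_le3 // cd_dotJ !v1 !mul1r.
  - by move=> k; rewrite cd_mul1l cd_Jmul v1 scale1r.
  - move=> k l j a b _ _ _; rewrite -!A; congr cd_mul; congr cd_mul.
    by rewrite A cd_mulJ v1 scale1r cd_mul1l.
have fK v k l : (forall j, cd_dot (v j) (v j) = 1) ->
    cancel (f v k l) (f (fun j => cd_conj (v j)) k l).
  move=> v1 a; rewrite /f cd_conjK -!A cd_mulJ v1 scale1r cd_mul1r.
  by rewrite A cd_mulJ v1 scale1r cd_mul1l.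
have u1 j : cd_dot (u j) (u j) = 1 by case: (uP j).
have uJ1 j : cd_dot (cd_conj (u j)) (cd_conj (u j)) = 1 by rewrite cd_dotJ.
have gK k l : cancel (f (fun j => cd_conj (u j)) k l) (f u k l).
  by move=> a; have := fK _ k l uJ1 a; rewrite /f !cd_conjK.
have [y xy yE] := congruent_phase x (fP _ u1) (fP _ uJ1) (fun k l => fK _ k l u1) gK.
apply: congruent_trans xy _.
have ui : u i = cd_one R _ by case: (uP i) => _ _; apply.
apply: (@congruent_real_row y i); first by rewrite yE /f ui cd_conj1 cd_mul1l cd_mul1r.
by move=> j; rewrite yE /f ui cd_conj1 cd_mul1l; case: (uP j).
Qed.

End points.
End transitivity.

(** * Transitivity in the octonionic plane *)
Section octonionic.
Variables (R : realType) (F : scalars).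
Local Notation K := (cd R (cd_level F)).
Implicit Types x y : FP R F 2.
Let k3 : (cd_level F <= 3)%N := cd_level_le3 F.
Local Notation "x ** y" := (cd_mul x y) (at level 40, left associativity).

(** Over the octonions diagonal conjugation fails. Instead one unit u acts by
    left, right and bilateral multiplication on the three off-diagonal
    entries; the three Moufang identities are exactly the compatibility with
    the product. *)
Definition triality (u : K) (i j : 'I_3) (a : K) : K :=
  match val i, val j with
  | 0, 1 => u ** a
  | 1, 0 => a ** cd_conj u
  | 1, 2 => a ** u
  | 2, 1 => cd_conj u ** a
  | 2, 0 => (cd_conj u ** a) ** cd_conj u
  | 0, 2 => (u ** a) ** u
  | _, _ => a
  end.

Lemma triality_phase u : cd_dot u u = 1 -> phase (triality u).
Proof.
move=> u1; have uJ1 : cd_dot (cd_conj u) (cd_conj u) = 1 by rewrite cd_dotJ.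
have uJ a : cd_conj u ** (u ** a) = a by rewrite cd_mulJK // u1 scale1r.
have uJr a : (a ** u) ** cd_conj u = a by rewrite cd_mulKJ // u1 scale1r.
have Ju a : u ** (cd_conj u ** a) = a by rewrite -{1}[u]cd_conjK cd_mulJK // uJ1 scale1r.
have Jur a : (a ** cd_conj u) ** u = a by rewrite -{2}[u]cd_conjK cd_mulKJ // uJ1 scale1r.
split; rewrite /triality.
- move=> [[|[|[|//]]] hi] [[|[|[|//]]] hj] a //=; rewrite ?cd_conjM ?cd_conjK ?cd_flexible //.
- by move=> [[|[|[|//]]] hi] [[|[|[|//]]] hj] a b //=; rewrite !(cd_mulDl, cd_mulDr).
- by move=> [[|[|[|//]]] hi] [[|[|[|//]]] hj] r a //=; rewrite !(cd_mulZl, cd_mulZr).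
- by move=> [[|[|[|//]]] hi] [[|[|[|//]]] hj] a b //=; rewrite !(cd_dotMl, cd_dotMr) // ?cd_dotJ ?u1 ?mul1r.
- by move=> [[|[|[|//]]] hi].
- move=> [[|[|[|//]]] hi] [[|[|[|//]]] hl] [[|[|[|//]]] hj] a b //= _ _ _.
  + exact: cd_moufangm.
  + by rewrite -cd_moufangl // Ju.
  + by rewrite -cd_moufangr // Jur.
  + by rewrite -cd_moufangr // uJr.
  + by rewrite -cd_moufangl // uJ.
  + exact: cd_moufangm.
Qed.

Lemma triality_cancel u i j : cd_dot u u = 1 ->
  cancel (triality u i j) (triality (cd_conj u) i j).
Proof.
move=> u1 a; have uJ1 : cd_dot (cd_conj u) (cd_conj u) = 1 by rewrite cd_dotJ.
have uJ b : cd_conj u ** (u ** b) = b by rewrite cd_mulJK // u1 scale1r.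
have uJr b : (b ** u) ** cd_conj u = b by rewrite cd_mulKJ // u1 scale1r.
have Ju b : u ** (cd_conj u ** b) = b by rewrite -{1}[u]cd_conjK cd_mulJK // uJ1 scale1r.
have Jur b : (b ** cd_conj u) ** u = b by rewrite -{2}[u]cd_conjK cd_mulKJ // uJ1 scale1r.
rewrite /triality.
case: i j => [[|[|[|//]]] hi] [[|[|[|//]]] hj] //=; rewrite ?cd_conjK ?uJ ?uJr ?Ju ?Jur //.
  by rewrite -cd_flexible // uJr uJ.
by rewrite -cd_flexible // Jur Ju.
Qed.

Lemma congruent_triality x (s : {perm 'I_3}) u : cd_dot u u = 1 ->
  exists2 y, congruent x y &
    forall i j, y i j = triality u (s i) (s j) (x i j).
Proof.
move=> u1; have uJ1 : cd_dot (cd_conj u) (cd_conj u) = 1 by rewrite cd_dotJ.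
have sP v : cd_dot v v = 1 -> phase (fun i j => triality v (s i) (s j)).
  move=> v1; have [pJ pD pZ pd p1 pM] := triality_phase v1; split => //.
  by move=> i l j a b il lj ij; apply: pM; rewrite (inj_eq perm_inj).
apply: (congruent_phase x (sP _ u1) (sP _ uJ1)) => i j.
  exact: triality_cancel.
by move=> a; have := triality_cancel (s i) (s j) uJ1 a; rewrite cd_conjK.
Qed.

(** Relabelling the indices lets the triality map act with its left
    multiplication on any prescribed entry. *)
Lemma congruent_real_entry x i j : i != j -> exists y,
  [/\ congruent x y, cd_conj (y i j) = y i j, forall l, y l l = x l l &
      forall k l, x k l = 0 -> y k l = 0].
Proof.
move=> ij; pose t := tperm i ord0; pose j' := t j.
have j'0 : j' != ord0.
  by rewrite /j' -(tpermL i ord0) (inj_eq perm_inj) eq_sym.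
pose o1 : 'I_3 := inord 1; have o1E : val o1 = 1%N by rewrite /= inordK.
have o10 : o1 != ord0 by rewrite -val_eqE o1E.
pose s := (t * tperm j' o1)%g.
have si : s i = ord0 by rewrite permM tpermL tpermD // eq_sym.
have sj : s j = o1 by rewrite permM -/j' tpermL.
have [u [u1 _ ur]] := unit_phase (x i j).
have [y xy yE] := congruent_triality x s u1.
have p := triality_phase u1.
exists y; split => //.
- by rewrite yE si sj /triality o1E.
- by move=> l; rewrite yE FP_diag (phaseZ p) (phase1 p).
- by move=> k l xkl; rewrite yE xkl -(scale0r (0 : K)) (phaseZ p) !scale0r.
Qed.

(** Jacobi step: a real off-diagonal entry is removed by a rotation in its
    coordinate plane. *)
Lemma congruent_zero_entry x : cd_conj (x ord0 (inord 1)) = x ord0 (inord 1) ->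
  exists2 y, congruent x y & y ord0 (inord 1) = 0.
Proof.
set o1 : 'I_3 := inord 1; have o1E : val o1 = 1%N by rewrite /= inordK.
move=> xr; have xE := cd_conj_real xr.
have [x0|x0] := eqVneq (cd_Re (x ord0 o1)) 0.
  by exists x; [exact: congruent_refl|rewrite xE x0 scale0r].
set b := cd_Re (x ord0 o1) in xE x0.
pose al := cd_Re (x ord0 ord0); pose be := cd_Re (x o1 o1).
pose de := (al - be) / 2.
pose r := Num.sqrt (de ^+ 2 + b ^+ 2).
have rr : r ^+ 2 = de ^+ 2 + b ^+ 2 by rewrite sqr_sqrtr // addr_ge0 // sqr_ge0.
(* (b, r - de) is an eigenvector of the real symmetric block [al, b; b, be],
   so the reflection built from it diagonalizes the block. *)
pose N2 := b ^+ 2 + (r - de) ^+ 2.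
have N2_gt0 : 0 < N2 by rewrite ltr_pwDl ?sqr_ge0 // lt_neqAle sqr_ge0 eq_sym sqrf_eq0 x0.
pose q := Num.sqrt N2.
have qq : q ^+ 2 = N2 by rewrite sqr_sqrtr // ltW.
have q0 : q != 0 by rewrite -sqrf_eq0 qq gt_eqF.
pose c := b / q; pose s := (r - de) / q.
have cs1 : c ^+ 2 + s ^+ 2 = 1 by rewrite !expr_div_n -mulrDl qq divff // gt_eqF.
have cs0 : c * s * (al - be) + b * (s ^+ 2 - c ^+ 2) = 0.
  have -> : al - be = 2 * de by rewrite /de; field.
  rewrite /c /s !expr_div_n; apply: (mulIf (expf_neq0 2 q0)).
  have : b * ((r ^+ 2 - de ^+ 2) - b ^+ 2) = 0 by rewrite rr; ring.
  move=> h; rewrite mul0r -[RHS]h; field.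
  by [].
pose Q : 'M[R]_3 := \matrix_(i, j)
  match val i, val j with
  | 0, 0 => c | 0, 1 => s | 1, 0 => s | 1, 1 => - c | 2, 2 => 1 | _, _ => 0
  end.
have o1l : lift ord0 ord0 = o1 :> 'I_3 by apply: val_inj; rewrite /= o1E.
have QQ : Q *m Q^T = 1%:M.
  apply/matrixP => -[[|[|[|//]]] hi] [[|[|[|//]]] hj];
    rewrite !mxE !big_ord_recl big_ord0 !mxE /= ?mulr1n ?mulr0n;
    by [ring | rewrite -[RHS]cs1; ring].
have [y xy yE] := congruent_rot x QQ.
exists y => //; rewrite yE !mxE !big_ord_recl big_ord0 !mxE !big_ord_recl !big_ord0 !mxE /= o1E /=.
rewrite !scale0r !addr0 !o1l.
have -> : x o1 ord0 = b *: cd_one R _ by rewrite -(FP_conj x) xE cd_conjZ cd_conj1.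
rewrite xE (FP_diag x ord0) (FP_diag x o1) -/al -/be.
rewrite !(scalerDr, scalerA) -!scalerDl.
rewrite -[RHS](scale0r (cd_one R _)); congr (_ *: _).
by rewrite -cs0; ring.
Qed.

(** A phase that makes one entry of a row real also changes the other one, so
    a rotation is used in between. Make the entry (0, 1) real and rotate it
    away; idempotence then says that the product of the two other off-diagonal
    entries vanishes, so one of them is zero. Every row is left with at most
    one non-real entry, which a last phase makes real. *)
Lemma congruent_base3 x : congruent x (MkFP (base_pointP R F 2)).
Proof.
set o1 : 'I_3 := inord 1; have o1E : val o1 = 1%N by rewrite /= inordK.
have o01 : ord0 != o1 by rewrite -val_eqE o1E.
have [y [xy yr _ _]] := congruent_real_entry x o01.
have [z yz z0] := congruent_zero_entry yr.
apply: (congruent_trans xy); apply: (congruent_trans yz) => {x xy y yr yz}.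
have oc (i : 'I_3) : [\/ i = ord0, i = o1 | i = ord_max].
  case: i => [[|[|[|//]]] hi]; [apply: Or31|apply: Or32|apply: Or33];
    by apply: val_inj; rewrite ?o1E.
have o1l : lift ord0 ord0 = o1 :> 'I_3 by apply: val_inj; rewrite /= o1E.
have oml : lift ord0 (lift ord0 ord0) = ord_max :> 'I_3 by apply: val_inj.
have z0' : z o1 ord0 = 0 by rewrite -(FP_conj z) z0 cd_conj0.
have z2 : z ord0 ord_max = 0 \/ z o1 ord_max = 0.
  (* In the entry (0, 1) of z z = z only the product through the index 2
     survives. *)
  have := FP_idem z ord0 o1.
  rewrite !big_ord_recl big_ord0 oml o1l z0 cd_mul0r cd_mul0l add0r add0r addr0.
  move/(congr1 (fun a => cd_dot a a)).
  rewrite -(FP_conj z o1) => h.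
  move: h; rewrite cd_dotMr // cd_dotJ [RHS](_ : _ = 0); last first.
    by rewrite /cd_dot cd_mul0l cd_Re0.
  by move/eqP; rewrite mulf_eq0 => /orP[] /eqP /cd_dot_eq0; [right|left].
have [i zi] := exists_diag_gt0 z.
have [j ij zj] : exists2 j, i != j & forall l, l != i -> l != j -> z i l = 0.
  have z2' : z ord_max ord0 = 0 \/ z ord_max o1 = 0.
    by case: z2 => h; [left|right]; rewrite -FP_conj h cd_conj0.
  have [->|->|->] := oc i.
  - by exists ord_max => // l; have [->|->|->] := oc l; rewrite ?eqxx.
  - exists ord_max; first by rewrite -val_eqE o1E.
    by move=> l; have [->|->|->] := oc l; rewrite ?eqxx.
  - case: z2' => h; [exists o1|exists ord0] => //; rewrite -?val_eqE ?o1E //;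
    by move=> l; have [->|->|->] := oc l; rewrite -!val_eqE ?o1E.
have [w [zw wr wd w0]] := congruent_real_entry z ij.
apply: congruent_trans zw _; apply: (@congruent_real_row _ _ _ w i).
  by rewrite wd.
move=> l; have [->|li] := eqVneq l i; first exact: FP_conj.
by have [->//|lj] := eqVneq l j; rewrite w0 ?cd_conj0 // zj.
Qed.
End octonionic.

Theorem FP_transitive (R : realType) (F : scalars) (n : nat) (x : FP R F n) :
  (F = Octonions -> n = 2) -> congruent x (MkFP (base_pointP R F n)).
Proof.
case: (boolP (cd_level F <= 2)%N) => [h _|]; first exact: congruent_base_assoc.
case: F x => // x _ h; have n2 : n = 2 by exact: h.
by subst n; exact: congruent_base3.
Qed.

(** * The affine chart *)
(** Labels of the real coordinates, one for each leaf of the doubling tree. *)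
Fixpoint cd_index (n : nat) : finType :=
  if n is m.+1 then (cd_index m + cd_index m)%type : finType else unit.

Lemma card_cd_index n : #|cd_index n| = (2 ^ n)%N.
Proof. by elim: n => [|n IH]; rewrite /= ?card_unit // card_sum IH expnS mul2n addnn. Qed.

Section coordinates.
Variable R : realType.

Fixpoint cd_coord n : cd R n -> cd_index n -> R :=
  match n return cd R n -> cd_index n -> R with
  | 0 => fun x _ => x
  | m.+1 => fun x e => match e with inl e => cd_coord x.1 e | inr e => cd_coord x.2 e end
  end.

Fixpoint cd_of_coord n : (cd_index n -> R) -> cd R n :=
  match n return (cd_index n -> R) -> cd R n with
  | 0 => fun f => f tt
  | m.+1 => fun f => (cd_of_coord (fun e => f (inl e)), cd_of_coord (fun e => f (inr e)))
  end.

Lemma cd_of_coordK n (f : cd_index n -> R) e : cd_coord (cd_of_coord f) e = f e.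
Proof. by elim: n f e => [|n IH] f /= => [[]|[e|e]] //; rewrite IH. Qed.

Lemma cd_dotE n (x y : cd R n) : cd_dot x y = \sum_e cd_coord x e * cd_coord y e.
Proof.
elim: n x y => [|n IH] x y; first by rewrite (big_pred1 tt) // => -[].
by rewrite cd_dotS !IH big_sumType.
Qed.

Lemma cd_coordB n (x y : cd R n) e : cd_coord (x - y) e = cd_coord x e - cd_coord y e.
Proof. by elim: n x y e => [|n IH] x y //= [e|e]; rewrite IH. Qed.

End coordinates.

Section chart.
Variables (R : realType) (F : scalars) (n : nat).
Hypothesis hO : F = Octonions -> n = 2.
Local Notation K := (cd R (cd_level F)).
Local Notation "x ** y" := (cd_mul x y) (at level 40, left associativity).
Implicit Types v : 'I_n -> K.

Lemma dim_FPE : #|(('I_n * cd_index (cd_level F))%type : finType)| = dim_FP F n.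
Proof. by rewrite card_prod card_ord card_cd_index; case: (F). Qed.

(** Homogeneous coordinates (1, v_1, ..., v_n). *)
Definition hom_coord v (i : 'I_n.+1) : K :=
  if unlift ord0 i is Some j then v j else cd_one R _.

Definition sqnorm v : R := \sum_j cd_dot (v j) (v j).

Lemma sqnorm_ge0 v : 0 <= sqnorm v.
Proof. by apply: sumr_ge0 => j _; exact: cd_dot_ge0. Qed.

Lemma hom_coord0 v : hom_coord v ord0 = cd_one R _.
Proof. by rewrite /hom_coord unlift_none. Qed.
Lemma hom_coordS v j : hom_coord v (lift ord0 j) = v j.
Proof. by rewrite /hom_coord liftK. Qed.
Lemma cd_dot11 m : cd_dot (cd_one R m) (cd_one R m) = 1.
Proof. by rewrite /cd_dot cd_conj1 cd_mul1l cd_Re1. Qed.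
Lemma hom_coord_sqnorm v : \sum_i cd_dot (hom_coord v i) (hom_coord v i) = 1 + sqnorm v.
Proof.
rewrite big_ord_recl hom_coord0 cd_dot11; congr (_ + _).
by apply: eq_bigr => j _; rewrite hom_coordS.
Qed.

(** This is what idempotence of the chart matrix needs. It is associativity
    for R, C and H. Over the octonions n = 2, so if the three indices are
    distinct one of the factors is the coordinate 1 and alternativity
    suffices; if two coincide, everything reduces to norms and the composition
    law. *)
Lemma hom_coord_contract v i l j :
  (cd_conj (hom_coord v i) ** hom_coord v l) ** (cd_conj (hom_coord v l) ** hom_coord v j)
  = cd_dot (hom_coord v l) (hom_coord v l) *: (cd_conj (hom_coord v i) ** hom_coord v j).
Proof.
have k3 := cd_level_le3 F.
have [->|li] := eqVneq l i; first by rewrite cd_Jmul cd_mul_reall.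
have [->|lj] := eqVneq l j; first by rewrite cd_Jmul cd_mul_realr.
have [->|ij] := eqVneq i j.
  rewrite -{2}[hom_coord v j]cd_conjK -cd_conjM cd_mulJ cd_Jmul scalerA.
  by rewrite cd_dotMr // cd_dotJ.
have [k2|k2] := boolP (cd_level F <= 2)%N.
  by rewrite -cd_mulA // (cd_mulA (hom_coord v l)) // cd_mulJ cd_mul_reall cd_mulZr.
have n2 : n = 2 by apply: hO; case: (F) k2.
have : [\/ i = ord0, l = ord0 | j = ord0].
  move: ij li lj; rewrite -!val_eqE; case: i j l => [i hi] [j hj] [l hl] /=.
  move=> ij li lj; have : [\/ i = 0, l = 0 | j = 0]%N.
    move: hi hj hl; rewrite n2; case: i ij li => [|i] ij li; first by constructor 1.
    case: j ij lj => [|j] ij lj; first by constructor 3.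
    by case: l li lj => [|l] li lj; [constructor 2|lia].
  by case=> h; [constructor 1|constructor 2|constructor 3]; apply: val_inj.
case=> ->; rewrite hom_coord0 ?cd_conj1 ?cd_mul1l ?cd_mul1r.
- by have := cd_mulJK (cd_conj (hom_coord v l)) (hom_coord v j) k3; rewrite cd_conjK cd_dotJ.
- by rewrite cd_dot11 scale1r.
- exact: cd_mulKJ.
Qed.

Definition chartmx v : 'M[K]_n.+1 :=
  \matrix_(i, j) ((1 + sqnorm v)^-1 *: (cd_conj (hom_coord v i) ** hom_coord v j)).

Lemma chartmxP v : is_projector (chartmx v).
Proof.
have v0 : 1 + sqnorm v != 0 by rewrite gt_eqF // ltr_pwDl // sqnorm_ge0.
apply/projectorP; split.
- by apply/matrixP => i j; rewrite !mxE cd_conjZ cd_conjM cd_conjK.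
- apply/matrixP => i j; rewrite !mxE.
  under eq_bigr do rewrite !mxE cd_mulZl cd_mulZr hom_coord_contract !scalerA.
  rewrite -scaler_suml -mulr_sumr hom_coord_sqnorm; congr (_ *: _).
  by rewrite mulfVK.
- under eq_bigr do rewrite mxE cd_Jmul scalerA.
  by rewrite -scaler_suml -mulr_sumr hom_coord_sqnorm mulVf // scale1r.
Qed.

Definition chart v : FP R F n := MkFP (chartmxP v).

Lemma chart_row v j : chart v ord0 j = (1 + sqnorm v)^-1 *: hom_coord v j.
Proof. by rewrite mxE hom_coord0 cd_conj1 cd_mul1l. Qed.

(** Two points of the chart are already separated by the first rows of their
    matrices: the row of v is (1, v) divided by 1 + |v|^2, from which v is
    recovered in a Lipschitz way on bounded sets. *)
Lemma chart_separation (B : R) u v : sqnorm u <= B -> sqnorm v <= B ->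
  mx_inner (chart u) (chart v) <=
  1 - (4 * (1 + B) ^+ 3)^-1 * sqnorm (fun j => u j - v j).
Proof.
move=> uB vB; have B0 : 0 <= B by apply: le_trans uB; exact: sqnorm_ge0.
set t := mx_inner _ _; set s := sqnorm (fun j => _).
set la := (1 + sqnorm u)^-1; set mu := (1 + sqnorm v)^-1.
pose de := la - mu.
pose S := \sum_j cd_dot (la *: u j - mu *: v j) (la *: u j - mu *: v j).
have S0 : 0 <= S by apply: sumr_ge0 => j _; exact: cd_dot_ge0.
have h1 : de ^+ 2 + S <= 2 * (1 - t).
  rewrite inner_dist (bigD1 ord0) //= -[X in X <= _]addr0 lerD //; last first.
    by apply: sumr_ge0 => i _; apply: sumr_ge0 => j _; exact: cd_dot_ge0.
  rewrite big_ord_recl !chart_row !hom_coord0 -scalerBl cd_dotZl cd_dotZr cd_dot11 mulr1.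
  rewrite -expr2 lerD2l; apply: ler_sum => j _.
  by rewrite !chart_row !hom_coordS.
have h2 : la ^+ 2 * s <= 2 * S + 2 * de ^+ 2 * sqnorm v.
  rewrite /s /sqnorm !mulr_sumr -big_split; apply: ler_sum => j _ /=.
  set d := la *: u j - mu *: v j.
  have e : la *: (u j - v j) = d - de *: v j.
    by rewrite /d /de scalerBr scalerBl opprB addrA subrK.
  have -> : la ^+ 2 * cd_dot (u j - v j) (u j - v j) = cd_dot (d - de *: v j) (d - de *: v j).
    by rewrite -e cd_dotZl cd_dotZr mulrA expr2.
  clearbody d; clear e; have := cd_dot_ge0 (d + de *: v j).
  rewrite !(cd_dotDl, cd_dotDr, cd_dotNl, cd_dotNr, cd_dotZl, cd_dotZr).
  rewrite (cd_dotC (v j) d); set p := cd_dot d _; set q := cd_dot d d.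
  by set r := cd_dot (v j) (v j); nra.
have h3 : (1 + B)^-1 ^+ 2 <= la ^+ 2.
  rewrite ler_sqr ?nnegrE ?invr_ge0 ?addr_ge0 ?sqnorm_ge0 //.
  by rewrite lef_pV2 ?posrE ?ltr_pwDl ?sqnorm_ge0 // lerD2l.
have s0 : 0 <= s by exact: sqnorm_ge0.
have h4 : (1 + B)^-1 ^+ 2 * s <= (1 + B) * (4 * (1 - t)).
  apply: le_trans (ler_wpM2r s0 h3) _; apply: le_trans h2 _.
  have v0 := sqnorm_ge0 v; have de0 := sqr_ge0 de.
  have : (1 + B) * (2 * (de ^+ 2 + S)) <= (1 + B) * (4 * (1 - t)).
    by rewrite ler_wpM2l ?addr_ge0 //; lra.
  apply: le_trans.
  have : de ^+ 2 * sqnorm v <= de ^+ 2 * B by rewrite ler_wpM2l.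
  have : 0 <= B * S by rewrite mulr_ge0.
  nra.
have b0 : 0 < 1 + B by rewrite ltr_pwDl.
have -> : (4 * (1 + B) ^+ 3)^-1 * s = ((1 + B)^-1 ^+ 2 * s) / (4 * (1 + B)).
  by field; rewrite gt_eqF.
rewrite lerBrDr addrC -lerBrDr ler_pdivrMr ?mulr_gt0 //.
by apply: le_trans h4 _; rewrite mulrC (mulrC 4) -!mulrA (mulrC 4) !mulrA mulrAC.
Qed.

End chart.

(** * Binomial series *)
Section kernels.
Variable R : realType.
Implicit Types (t p x y : R) (n k T : nat).

Lemma MVT_is_derive (f df : R -> R) (a b : R) : a <= b ->
  (forall x, x \in `[a, b] -> is_derive x 1 f (df x)) ->
  exists2 c, c \in `[a, b] & f b - f a = df c * (b - a).
Proof.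
move=> ab fdf.
have fdf' x : x \in `]a, b[ -> is_derive x 1 f (df x).
  by move=> xab; apply: fdf; move: x xab; exact: subset_itv_oo_cc.
apply: (@MVT_segment R f df a b ab fdf'); apply: continuous_in_subspaceT => x.
rewrite inE => xab; have [dx _] := fdf x xab.
by apply: differentiable_continuous; exact/derivable1_diffP.
Qed.

Lemma powR_sub1 x p : 0 < x -> x `^ p = x `^ (p - 1) * x.
Proof.
move=> x0; rewrite -{3}[x]powRr1 ?ltW // -powRD ?subrK //.
by apply/implyP => _; rewrite gt_eqF.
Qed.

Lemma is_derive_Xn n t : is_derive t (1 : R) (fun t : R => t ^+ n) (n%:R * t ^+ n.-1).
Proof.
have -> : (fun t : R => t ^+ n) = (@id R) ^+ n.
  by rewrite exprfctE.
apply: (is_derive_eq (@is_deriveX R R (@id R) n t 1 1 (is_derive_id _ _))).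
by rewrite [_ *: _]mulr1.
Qed.

Section binomial.
Variables (p : R).
Hypothesis p0 : 0 < p.

(** Taylor coefficients of (1 - t)^(-p). *)
Definition riesz_coef n : R := \prod_(j < n) ((p + j%:R) / j.+1%:R).

Lemma riesz_coefS n : riesz_coef n.+1 = riesz_coef n * ((p + n%:R) / n.+1%:R).
Proof. by rewrite /riesz_coef big_ord_recr. Qed.

Lemma riesz_coef_ge0 n : 0 <= riesz_coef n.
Proof.
by apply: prodr_ge0 => j _; rewrite divr_ge0 // addr_ge0 // ltW.
Qed.

Definition riesz_psum n t : R := \sum_(k < n) riesz_coef k * t ^+ k.

(** Sum of the first coefficients in closed form; it converts the bound on the
    sums into one on single coefficients. *)
Lemma riesz_coef_sum n : n%:R * riesz_coef n = p * \sum_(k < n) riesz_coef k.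
Proof.
elim: n => [|n IH]; first by rewrite mul0r big_ord0 mulr0.
rewrite big_ord_recr /= mulrDr -IH riesz_coefS -natr1.
by field; rewrite natr1.
Qed.

(** Multiplying the partial sum by (1 - t)^p makes the derivative telescope to
    a single term. *)
Lemma is_derive_riesz_psum n t : t < 1 ->
  is_derive t 1 (fun t => (1 - t) `^ p * riesz_psum n t)
    (- (n%:R * riesz_coef n * t ^+ n.-1 * (1 - t) `^ (p - 1))).
Proof.
move=> t1; have s0 : 0 < 1 - t by rewrite subr_gt0.
have dp : is_derive t 1 (fun t => (1 - t) `^ p) (- (p * (1 - t) `^ (p - 1))).
  have d1 : is_derive t (1 : R) (fun t : R => 1 - t) (- 1).
    apply: (is_derive_eq (is_deriveB (is_derive_cst (1 : R) t 1) (is_derive_id t 1))).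
    by rewrite sub0r.
  have d2 := is_derive1_powR p s0.
  have := @is_derive1_comp _ (fun x => x `^ p) (fun t => 1 - t) t _ _ d2 d1.
  by rewrite mulrN1.
elim: n => [|n IH].
  rewrite !mul0r oppr0 (_ : (fun _ => _) = cst 0); first exact: is_derive_cst.
  by apply/funext => x; rewrite /riesz_psum big_ord0 mulr0.
have -> : (fun t => (1 - t) `^ p * riesz_psum n.+1 t) =
    (fun t => (1 - t) `^ p * riesz_psum n t + (1 - t) `^ p * (riesz_coef n * t ^+ n)).
  by apply/funext => x; rewrite /riesz_psum big_ord_recr mulrDr.
have dX : is_derive t 1 (fun t => riesz_coef n * t ^+ n) (riesz_coef n * (n%:R * t ^+ n.-1)).
  exact: (is_deriveZ (riesz_coef n) (is_derive_Xn n t)).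
apply: (is_derive_eq (is_deriveD IH (is_deriveM dp dX))).
have e : n%:R * t ^+ n.-1 * t = n%:R * t ^+ n.
  by case: (n) => [|m]; rewrite ?mul0r // -mulrA -exprSr.
rewrite riesz_coefS (powR_sub1 p s0) /= -natr1 /GRing.scale /=.
set X := (1 - t) `^ (p - 1); set a := riesz_coef n.
transitivity (- (a * X * ((n%:R * t ^+ n.-1 * t) + p * t ^+ n))); first by ring.
rewrite e; field.
by rewrite natr1.
Qed.

Lemma geometric_sum_le (r : R) n : 0 <= r < 1 -> \sum_(k < n) r ^+ k <= (1 - r)^-1.
Proof.
move=> /andP[r0 r1]; rewrite -[leRHS]mul1r ler_pdivlMr ?subr_gt0 //.
have := subrX1 r n; rewrite -opprB -[r - 1]opprB mulNr => /oppr_inj.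
by rewrite mulrC => <-; rewrite gerBl exprn_ge0.
Qed.

Lemma natmul_expr_le (r : R) n : 0 <= r < 1 -> n%:R * r ^+ n <= (1 - r)^-1.
Proof.
move=> r01; apply: le_trans (geometric_sum_le n r01).
rewrite mulr_natl -[X in _ *+ X]card_ord -sumr_const; apply: ler_sum => k _.
by case/andP: r01 => r0 r1; apply: ler_wiXn2l => //; [exact: ltW|exact: ltnW].
Qed.

(** Mean value theorem for the function of the preceding lemma, which equals
    one at 0. *)
Lemma riesz_psum_gap n t : 0 <= t < 1 ->
  exists2 d, 0 <= d <= n.+1%:R * riesz_coef n.+1 * t ^+ n.+1 / (1 - t) &
    (1 - t) `^ p * riesz_psum n.+1 t = 1 - d.
Proof.
move=> /andP[t0 t1].
have dd x : x \in `[0, t] -> is_derive x 1 (fun t => (1 - t) `^ p * riesz_psum n.+1 t)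
    (- (n.+1%:R * riesz_coef n.+1 * x ^+ n * (1 - x) `^ (p - 1))).
  by rewrite in_itv /= => /andP[_ xt]; apply: is_derive_riesz_psum; apply: le_lt_trans t1.
have [c] := MVT_is_derive t0 dd.
rewrite in_itv /= => /andP[c0 ct]; rewrite !subr0 powR1 mul1r.
have -> : riesz_psum n.+1 0 = 1.
  rewrite /riesz_psum big_ord_recl expr0 mulr1 big1 ?addr0 => [|i _].
    by rewrite /riesz_coef big_ord0.
  by rewrite exprS mul0r mulr0.
move=> /eqP; rewrite subr_eq => /eqP ->.
have c1 : 0 < 1 - c by rewrite subr_gt0 (le_lt_trans ct).
have s0 : 0 < 1 - t by rewrite subr_gt0.
have a0 := riesz_coef_ge0 n.+1.
exists (n.+1%:R * riesz_coef n.+1 * c ^+ n * (1 - c) `^ (p - 1) * t); last first.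
  by rewrite addrC mulNr.
apply/andP; split.
  by rewrite !mulr_ge0 ?powR_ge0 ?exprn_ge0 ?ler0n.
rewrite -!mulrA ler_wpM2l ?ler0n // ler_wpM2l // exprSr -mulrA.
apply: ler_pM; rewrite ?exprn_ge0 ?mulr_ge0 ?powR_ge0 //.
  by rewrite lerXn2r ?nnegrE.
rewrite mulrC ler_wpM2l //.
have : (1 - c) `^ (p - 1) * (1 - c) <= 1.
  rewrite -powR_sub1 //; apply: (@le_trans _ _ (1 `^ p)); last by rewrite powR1.
  by rewrite ge0_ler_powR ?nnegrE ?(ltW p0) ?(ltW c1) ?gerBl.
rewrite -ler_pdivlMr // => /le_trans; apply.
by rewrite mul1r lef_pV2 ?posrE // lerD2l lerN2.
Qed.

Lemma riesz_psum_le n t : 0 <= t < 1 -> riesz_psum n t <= (1 - t) `^ (- p).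
Proof.
move=> t01; have [t0 t1] := andP t01.
have s0 : 0 < (1 - t) `^ p by rewrite powR_gt0 // subr_gt0.
rewrite powRN -[leRHS]mul1r ler_pdivlMr // mulrC.
case: n => [|n]; first by rewrite /riesz_psum big_ord0 mulr0.
by have [d /andP[d0 _] ->] := riesz_psum_gap n t01; rewrite gerBl.
Qed.

(** Evaluate the bound on partial sums at t = 1 - 1/(2T), where all powers t^k
    with k < T are at least 1/2. *)
Lemma sum_riesz_coef_le T : (0 < T)%N ->
  \sum_(k < T) riesz_coef k <= 2 * 2 `^ p * T%:R `^ p.
Proof.
move=> T0; pose t : R := 1 - (2 * T%:R)^-1.
have T0' : (0 : R) < 2 * T%:R by rewrite mulr_gt0 // ltr0n.
have T1 : (2 * T%:R)^-1 <= (1 : R).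
  by rewrite invf_le1 // -natrM ler1n muln_gt0.
have t01 : 0 <= t < 1 by rewrite subr_ge0 T1 /= gtrBl invr_gt0.
have /= h := riesz_psum_le T t01.
have -> : 2 * 2 `^ p * T%:R `^ p = 2 * (1 - t) `^ (- p).
  rewrite /t subKr -(powR_inv1 (ltW T0')) -powRrM mulrNN mul1r.
  by rewrite powRM // mulrA.
rewrite -ler_pdivrMl //; apply: le_trans h; rewrite mulr_sumr; apply: ler_sum => k _.
rewrite mulrC ler_wpM2l ?riesz_coef_ge0 //.
have B m : 1 - m%:R * (2 * T%:R)^-1 <= t ^+ m.
  elim: m => [|m IH]; first by rewrite mul0r subr0.
  rewrite exprS; apply: le_trans (ler_wpM2l (proj1 (andP t01)) IH).
  rewrite /t -natr1; set u := _^-1; have u0 : 0 <= u by rewrite invr_ge0 ltW.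
  have : 0 <= m%:R * (u * u) by rewrite !mulr_ge0.
  by lra.
apply: le_trans (B k); rewrite lerBrDr -lerBrDl.
rewrite ler_pdivrMr // (_ : 1 - 2^-1 = 2^-1); last by field.
by rewrite mulrA mulVf // mul1r ler_nat ltnW.
Qed.

Lemma riesz_coef_le T : (0 < T)%N ->
  riesz_coef T <= p * (2 * 2 `^ p) * T%:R `^ (p - 1).
Proof.
move=> T0; have T0' : (0 : R) < T%:R by rewrite ltr0n.
rewrite -(ler_pM2l T0') riesz_coef_sum.
rewrite (_ : T%:R * _ = p * (2 * 2 `^ p * T%:R `^ p)).
  by rewrite ler_pM2l // sum_riesz_coef_le.
by rewrite (powR_sub1 p T0'); ring.
Qed.

Lemma riesz_coef_ge T : (0 < T)%N -> p / T%:R <= riesz_coef T.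
Proof.
move=> T0; have T0' : (0 : R) < T%:R by rewrite ltr0n.
rewrite ler_pdivrMr // mulrC riesz_coef_sum.
rewrite -[leLHS]mulr1 ler_pM2l //; case: T T0 {T0'} => // T _.
rewrite big_ord_recl {1}/riesz_coef big_ord0 lerDl; apply: sumr_ge0 => i _.
exact: riesz_coef_ge0.
Qed.

Lemma riesz_psum_cvg t : 0 <= t < 1 -> riesz_psum n t @[n --> \oo] --> (1 - t) `^ (- p).
Proof.
move=> t01; have [t0 t1] := andP t01.
(* With t = s^4, the bound n a_n t^n is shared out among the factors: n s^n
   and a_n s^n are bounded, and s^n tends to 0. *)
pose s := Num.sqrt (Num.sqrt t).
have s01 : 0 <= s < 1.
  by rewrite sqrtr_ge0 -[X in _ < X]sqrtr1 ltr_sqrt // -[X in _ < X]sqrtr1 ltr_sqrt.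
have [s0 s1] := andP s01.
have sE : t = s ^+ 4 by rewrite (exprM s 2 2) !sqr_sqrtr ?sqrtr_ge0.
set B := (1 - s) `^ (- p).
have aB n : riesz_coef n * s ^+ n <= B.
  apply: le_trans (riesz_psum_le n.+1 s01); rewrite /riesz_psum big_ord_recr /= lerDr.
  by apply: sumr_ge0 => k _; rewrite mulr_ge0 ?riesz_coef_ge0 ?exprn_ge0.
pose C := (1 - t) `^ (- p) * ((1 - s)^-1 * B / (1 - t)).
have bound n : n%:R * riesz_coef n * t ^+ n <= (1 - s)^-1 * B * s ^+ n.
  have -> : n%:R * riesz_coef n * t ^+ n =
      (n%:R * s ^+ n) * (riesz_coef n * s ^+ n) * s ^+ n * s ^+ n.
    by rewrite sE -exprM mulnC; rewrite (_ : (n * 4 = n + n + n + n)%N) ?exprD; [ring|lia].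
  rewrite -[leRHS]mulr1; apply: ler_pM; rewrite ?mulr_ge0 ?exprn_ge0 ?riesz_coef_ge0 ?ler0n //.
    rewrite ler_wpM2r ?exprn_ge0 //; apply: ler_pM;
      rewrite ?mulr_ge0 ?exprn_ge0 ?riesz_coef_ge0 ?ler0n //.
    exact: natmul_expr_le.
  by rewrite exprn_ile1 // ltW.
have st0 : 0 < 1 - t by rewrite subr_gt0.
have P0 : 0 < (1 - t) `^ p by rewrite powR_gt0.
apply: (@squeeze_cvgr _ _ _ _ (fun n => (1 - t) `^ (- p) - C * s ^+ n)
   (fun=> (1 - t) `^ (- p))).
- near=> n; rewrite riesz_psum_le // andbT.
  have n0 : (0 < n)%N by near: n; exact: nbhs_infty_gt.
  have [m nE] : exists m, n = m.+1 by exists n.-1; rewrite prednK.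
  rewrite nE; have [d /andP[d0 dle] gE] := riesz_psum_gap m t01.
  have -> : riesz_psum m.+1 t = (1 - t) `^ (- p) - (1 - t) `^ (- p) * d.
    by rewrite -{1}[(1 - t) `^ (- p)]mulr1 -mulrBr -gE mulrA powRN mulVf ?mul1r // gt_eqF.
  rewrite lerD2l lerN2 (_ : C * _ = (1 - t) `^ (- p) * ((1 - s)^-1 * B * s ^+ m.+1 / (1 - t))).
    rewrite ler_wpM2l ?powR_ge0 // (le_trans dle) // ler_wpM2r ?invr_ge0 ?(ltW st0) //.
  rewrite /C -mulrA; congr (_ * _); exact: mulrAC.
- have cs : s ^+ n @[n --> \oo] --> 0.
    by apply: cvg_expr; rewrite ger0_norm.
  rewrite -[X in _ --> X]subr0 -(mulr0 C).
  apply: cvgB; first exact: cvg_cst.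
  by apply: cvgM => //; exact: cvg_cst.
- exact: cvg_cst.
Unshelve. all: by end_near.
Qed.

End binomial.
End kernels.

(** * Logarithmic series and tail sums *)
Section logarithm.
Variable R : realType.
Implicit Types (t p x y : R) (n k T : nat).

Definition log_coef n : R := (2 * n%:R)^-1.
Definition log_psum n t : R := \sum_(k < n) log_coef k * t ^+ k.

Lemma log_coef_ge0 n : 0 <= log_coef n.
Proof. by rewrite invr_ge0 mulr_ge0. Qed.

Lemma is_derive_log_psum n t : t < 1 ->
  is_derive t 1 (fun t => 2^-1 * ln (1 - t) + log_psum n.+1 t)
    (- (2^-1 * (t ^+ n / (1 - t)))).
Proof.
move=> t1; have s0 : 0 < 1 - t by rewrite subr_gt0.
have dl : is_derive t 1 (fun t => ln (1 - t)) (- (1 - t)^-1).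
  have d1 : is_derive t (1 : R) (fun t : R => 1 - t) (- 1).
    apply: (is_derive_eq (is_deriveB (is_derive_cst (1 : R) t 1) (is_derive_id t 1))).
    by rewrite sub0r.
  have d2 := is_derive1_ln s0.
  have := @is_derive1_comp _ (fun x => ln x) (fun t => 1 - t) t _ _ d2 d1.
  by rewrite mulrN1.
elim: n => [|n IH].
  rewrite (_ : (fun _ => _) = 2^-1 \*: (fun t => ln (1 - t))); last first.
    apply/funext => x; rewrite /log_psum big_ord_recl big_ord0 /log_coef mulr0 invr0.
    by rewrite mul0r !addr0.
  apply: (is_derive_eq (is_deriveZ 2^-1 dl)).
  by rewrite mul1r; exact: mulrN.
have -> : (fun t => 2^-1 * ln (1 - t) + log_psum n.+2 t) =
    (fun t => 2^-1 * ln (1 - t) + log_psum n.+1 t + log_coef n.+1 * t ^+ n.+1).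
  by apply/funext => x; rewrite /log_psum big_ord_recr addrA.
have dX : is_derive t 1 (fun t => log_coef n.+1 * t ^+ n.+1)
    (log_coef n.+1 * (n.+1%:R * t ^+ n)).
  exact: (is_deriveZ (log_coef n.+1) (is_derive_Xn n.+1 t)).
apply: (is_derive_eq (is_deriveD IH dX)).
rewrite /log_coef exprS; field.
by rewrite gt_eqF //= addrC natr1.
Qed.

Lemma log_psum_gap n t : 0 <= t < 1 ->
  exists2 d, 0 <= d <= t ^+ n.+1 / (1 - t) &
    log_psum n.+1 t = - (2^-1 * ln (1 - t)) - d.
Proof.
move=> /andP[t0 t1].
have dd x : x \in `[0, t] -> is_derive x 1 (fun t => 2^-1 * ln (1 - t) + log_psum n.+1 t)
    (- (2^-1 * (x ^+ n / (1 - x)))).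
  by rewrite in_itv /= => /andP[_ xt]; apply: is_derive_log_psum; apply: le_lt_trans t1.
have [c] := MVT_is_derive t0 dd.
rewrite in_itv /= => /andP[c0 ct]; rewrite !subr0 ln1 mulr0 add0r.
have -> : log_psum n.+1 0 = 0.
  rewrite /log_psum big_ord_recl /log_coef mulr0 invr0 mul0r big1 ?addr0 => // i _.
  by rewrite exprS mul0r mulr0.
rewrite subr0 => h.
have c1 : 0 < 1 - c by rewrite subr_gt0 (le_lt_trans ct).
have s0 : 0 < 1 - t by rewrite subr_gt0.
exists (2^-1 * (c ^+ n / (1 - c)) * t); last first.
  by rewrite -[X in _ = _ + X]mulNr -h addKr.
have q0 : 0 <= c ^+ n / (1 - c) by rewrite divr_ge0 ?exprn_ge0 // ltW.
apply/andP; split; first by rewrite mulr_ge0 // mulr_ge0.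
apply: (@le_trans _ _ (c ^+ n / (1 - c) * t)).
  by rewrite ler_wpM2r // ler_piMl // invf_le1 // ler1n.
rewrite exprSr mulrAC; apply: ler_pM; rewrite ?mulr_ge0 ?exprn_ge0 ?invr_ge0 ?(ltW c1) //.
  by rewrite ler_wpM2r // lerXn2r ?nnegrE.
by rewrite lef_pV2 ?posrE // lerD2l lerN2.
Qed.

Lemma log_psum_le n t : 0 <= t < 1 -> log_psum n t <= - (2^-1 * ln (1 - t)).
Proof.
move=> t01; case: n => [|n]; last first.
  by have [d /andP[d0 _] ->] := log_psum_gap n t01; rewrite gerBl.
rewrite /log_psum big_ord0 -mulrN mulr_ge0 // oppr_ge0 ln_le0 // gerBl.
by case/andP: t01.
Qed.

Lemma log_psum_cvg t : 0 <= t < 1 -> log_psum n t @[n --> \oo] --> - (2^-1 * ln (1 - t)).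
Proof.
move=> t01; have [t0 t1] := andP t01.
set l := - _; pose C := (1 - t)^-1.
apply: (@squeeze_cvgr _ _ _ _ (fun n => l - C * t ^+ n) (fun=> l)).
- near=> n; rewrite log_psum_le // andbT.
  have n0 : (0 < n)%N by near: n; exact: nbhs_infty_gt.
  have [m nE] : exists m, n = m.+1 by exists n.-1; rewrite prednK.
  rewrite nE; have [d /andP[d0 dle] ->] := log_psum_gap m t01.
  by rewrite lerD2l lerN2 /C mulrC.
- have cs : t ^+ n @[n --> \oo] --> 0.
    by apply: cvg_expr; rewrite ger0_norm.
  rewrite -[X in _ --> X]subr0 -(mulr0 C).
  apply: cvgB; first exact: cvg_cst.
  by apply: cvgM => //; exact: cvg_cst.
- exact: cvg_cst.
Unshelve. all: by end_near.
Qed.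

(** The constant in front of ln T must be exactly 1/2: it becomes the 1/D of
    the logarithmic estimate. *)
Lemma sum_log_coef_le T : (0 < T)%N ->
  \sum_(k < T) log_coef k <= 2^-1 * (1 + ln T%:R).
Proof.
(* The induction needs the bound one index earlier: ln (n + 2) - ln (n + 1) is
   at least 1 / (n + 2) but not 1 / (n + 1). *)
have H n : \sum_(k < n.+2) log_coef k <= 2^-1 * (1 + ln n.+1%:R).
  elim: n => [|n IH].
    by rewrite !big_ord_recl big_ord0 /log_coef mulr0 invr0 add0r addr0 ln1 addr0 !mulr1.
  rewrite big_ord_recr /=; apply: le_trans (lerD IH (lexx _)) _.
  have n2 : (0 : R) < n.+2%:R by rewrite ltr0n.
  have n1 : (0 : R) < n.+1%:R by rewrite ltr0n.
  have : ln (n.+1%:R / n.+2%:R : R) <= - n.+2%:R^-1.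
    have -> : (n.+1%:R / n.+2%:R : R) = 1 + - n.+2%:R^-1.
      have n2' : n.+2%:R != 0 :> R by rewrite gt_eqF.
      apply: (mulIf n2'); rewrite mulfVK // mulrDl mul1r mulNr mulVf //.
      by rewrite -[n.+2%:R]natr1 addrK.
    by apply: le_ln1Dx; rewrite ltrN2 invf_lt1 // ltr1n.
  rewrite ln_div ?posrE // /log_coef invfM.
  move: (ln n.+1%:R) (ln n.+2%:R) (n.+2%:R^-1) => u v w; lra.
case: T => [|[|n]] // _.
  by rewrite big_ord_recl big_ord0 /log_coef mulr0 invr0 addr0 ln1 addr0 mulr1.
apply: le_trans (H n) _; rewrite ler_pM2l // lerD2l ler_ln ?posrE ?ltr0n //.
by rewrite ler_nat.
Qed.

(** Each term is dominated by a difference of consecutive values of k^(-b), by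
    the mean value theorem, and the sum telescopes. *)
Lemma tail_powR_le (b : R) T n : 0 < b -> (0 < T)%N ->
  \sum_(T <= k < n) k%:R `^ (- b - 1) <= 2 `^ (b + 1) / b * T%:R `^ (- b).
Proof.
move=> b0 T0.
have step k : (0 < k)%N -> k%:R `^ (- b - 1) <=
    2 `^ (b + 1) / b * (k%:R `^ (- b) - k.+1%:R `^ (- b)).
  move=> k0; have k0' : (0 : R) < k%:R by rewrite ltr0n.
  have kk : k%:R <= k.+1%:R :> R by rewrite ler_nat.
  have dd x : x \in `[k%:R, k.+1%:R] -> is_derive x 1 (fun y : R => y `^ (- b)) (- b * x `^ (- b - 1)).
    rewrite in_itv /= => /andP[kx _]; apply: is_derive1_powR.
    exact: lt_le_trans kx.
  have [c] := MVT_is_derive kk dd.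
  rewrite in_itv /= => /andP[kc ck].
  have -> : k.+1%:R - k%:R = 1 :> R by rewrite -natr1 addrAC subrr add0r.
  rewrite mulr1 => h; rewrite -[X in _ <= _ * X]opprB h mulNr opprK mulrA divfK ?gt_eqF //.
  have -> : - b - 1 = - (b + 1) by rewrite opprD.
  have c0 : 0 < c by apply: lt_le_trans kc.
  rewrite !powRN ler_pdivlMr ?powR_gt0 // mulrC ler_pdivrMr ?powR_gt0 // -powRM ?(ltW k0') //.
  have b1 : 0 <= b + 1 by rewrite addr_ge0 // ltW.
  have k2 : (0 : R) <= 2 * k%:R by rewrite mulr_ge0 // ltW.
  rewrite ge0_ler_powR ?nnegrE ?(ltW c0) //.
  by apply: le_trans ck _; rewrite -natr1 mulr_natl mulr2n lerD2l ler1n.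
set A := 2 `^ (b + 1) / b; have A0 : 0 <= A by rewrite divr_ge0 ?powR_ge0 // ltW.
have [nT|Tn] := leqP n T; first by rewrite big_geq // mulr_ge0 ?powR_ge0.
apply: (@le_trans _ _ (A * (T%:R `^ (- b) - n%:R `^ (- b)))); last first.
  by rewrite ler_wpM2l // gerBl powR_ge0.
elim: n Tn => // n IH; rewrite ltnS leq_eqVlt => /predU1P[<-|Tn].
  by rewrite big_nat1 step.
rewrite big_nat_recr /= ?(ltnW Tn) //.
apply: le_trans (lerD (IH Tn) (step n (leq_trans T0 (ltnW Tn)))) _.
by rewrite -mulrDr subrKA.
Qed.

End logarithm.

(** * Energies of kernels with a positive power series *)
Lemma integral_cst_prob d (T : measurableType d) (R : realType)
  (P : probability T R) (c : \bar R) : (\int[P]__ c = c)%E.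
Proof.
rewrite integral_cst // [X in (_ * X)%E](_ : _ = 1%E) ?mule1 //.
exact: probability_setT.
Qed.

Section gram.
Context d (T : measurableType d) (R : realType) (P : probability T R).

Definition bounded_mfun (f : T -> R) :=
  measurable_fun setT f /\ exists M, forall x, `|f x| <= M.

(** Positive definite kernels with an explicit finite feature map. Closure
    under products is then immediate, and integrating against a measure is
    integrating finitely many features. *)
Definition gram_kernel (k : T -> T -> R) := exists (I : finType) (f : I -> T -> R),
  (forall i, bounded_mfun (f i)) /\ forall x y, k x y = \sum_i f i x * f i y.

Lemma gram_kernel_exp k n : gram_kernel k -> gram_kernel (fun x y => k x y ^+ n).
Proof.
move=> gk; elim: n => [|n [J [g [gb gE]]]].
  exists unit, (fun _ _ => 1); split => [i|x y].
    by split; [exact: measurable_cst|exists 1 => x; rewrite normr1].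
  by rewrite expr0 (big_pred1 tt) ?mulr1 // => -[].
have [I [f [fb fE]]] := gk.
exists (I * J)%type, (fun ij x => f ij.1 x * g ij.2 x); split => [[i j]|x y] /=.
  have [[mf [Mf fM]] [mg [Mg gM]]] := (fb i, gb j).
  split; first exact: measurable_funM.
  by exists (Mf * Mg) => x; rewrite normrM ler_pM.
rewrite exprS gE fE big_distrlr /= pair_big /=.
by apply: eq_bigr => -[i j] _ /=; rewrite mulrACA.
Qed.

Lemma bounded_mfun_integrable f : bounded_mfun f -> P.-integrable setT (EFin \o f).
Proof.
move=> [mf [M fM]]; apply: measurable_bounded_integrable => //.
  by apply: (@le_lt_trans _ _ 1%E); [exact: probability_le1|exact: ltry].
exists M; split; first exact: num_real.
by move=> N MN x _ /=; apply: le_trans (fM x) (ltW MN).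
Qed.

(** With m the mean feature vector, constancy of the potential gives |m|^2 = M
    and <f(w_i), m> = M for every i; the claim is that the squared norm of
    sum_i (f(w_i) - m) is nonnegative. *)
Lemma mean_energy_le k (M : R) : gram_kernel k ->
  (forall x, \int[P]_y (k x y)%:E = M%:E)%E ->
  forall (I : finType) (w : I -> T),
  #|I|%:R ^+ 2 * M <= \sum_i \sum_j k (w i) (w j).
Proof.
move=> [J [f [fb fE]]] kM I w.
have fint j := bounded_mfun_integrable (fb j).
pose m j := fine (\int[P]_y (f j y)%:E).
have mE j : (\int[P]_y (f j y)%:E)%E = (m j)%:E.
  by rewrite fineK //; apply: integrable_fin_num => //; exact: fint.
have UE x : \sum_j f j x * m j = M.
  apply: EFin_inj; rewrite -(kM x) -sumEFin.
  under [RHS]eq_integral do rewrite fE -sumEFin.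
  rewrite integral_sum //= => [|j]; last first.
    by under eq_fun do rewrite EFinM; apply: integrableZl => //; exact: fint.
  apply: eq_bigr => j _; rewrite EFinM -mE -integralZl //.
  exact: fint.
have mm : \sum_j m j * m j = M.
  apply: EFin_inj; rewrite -sumEFin.
  transitivity (\int[P]_x (\sum_j (f j x * m j)%:E))%E; last first.
    under eq_integral do rewrite sumEFin UE.
    exact: (integral_cst_prob P M%:E).
  rewrite integral_sum //= => [|j]; last first.
    under eq_fun do rewrite mulrC EFinM; apply: integrableZl => //; exact: fint.
  apply: eq_bigr => j _; rewrite EFinM -{1}mE.
  under [RHS]eq_integral do rewrite mulrC EFinM.
  rewrite integralZl //; first exact: muleC.
  exact: fint.
rewrite -subr_ge0; have -> : \sum_i \sum_j k (w i) (w j) - #|I|%:R ^+ 2 * M =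
    \sum_j (\sum_i f j (w i) - #|I|%:R * m j) ^+ 2.
  under [RHS]eq_bigr do rewrite sqrrB.
  rewrite big_split sumrB /=.
  have -> : \sum_j (\sum_i f j (w i)) ^+ 2 = \sum_i \sum_j k (w i) (w j).
    under eq_bigr do rewrite expr2 big_distrlr /=.
    rewrite exchange_big; apply: eq_bigr => i _; rewrite exchange_big.
    by apply: eq_bigr => l _; rewrite fE.
  have -> : \sum_j (\sum_i f j (w i)) * (#|I|%:R * m j) *+ 2 = #|I|%:R ^+ 2 * M *+ 2.
    rewrite sumrMnl; congr (_ *+ 2).
    under eq_bigr do rewrite mulrCA.
    rewrite -mulr_sumr expr2 -mulrA; congr (_ * _).
    under eq_bigr do rewrite mulr_suml.
    rewrite exchange_big /=; under eq_bigr do rewrite UE.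
    by rewrite sumr_const mulr_natl.
  have -> : \sum_j (#|I|%:R * m j) ^+ 2 = #|I|%:R ^+ 2 * M.
    by rewrite -mm mulr_sumr; apply: eq_bigr => j _; rewrite exprMn -expr2.
  by rewrite mulr2n; ring.
by apply: sumr_ge0 => j _; exact: sqr_ge0.
Qed.

End gram.

Section series_kernel.
Context d (T : measurableType d) (R : realType) (P : probability T R).
Variables (t : T -> T -> R) (M : nat -> R).
Hypothesis t_gram : gram_kernel t.
Hypothesis t0 : forall x y, 0 <= t x y.
Hypothesis txx : forall x, t x x = 1.
Hypothesis tM : forall k x, (\int[P]_y (t x y ^+ k)%:E = (M k)%:E)%E.
Variables (a : nat -> R) (K : T -> T -> \bar R).
Hypothesis a0 : forall k, 0 <= a k.
Hypothesis KE : forall x y, K x y = (\sum_(0 <= k <oo) (a k * t x y ^+ k)%:E)%E.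

Lemma gram_kernel_measurable (k : T -> T -> R) x : gram_kernel k -> measurable_fun setT (k x).
Proof.
move=> [J [f [fb fE]]]; rewrite (_ : k x = fun y => \sum_j f j x * f j y).
  apply: measurable_sum => j; apply: measurable_funM; first exact: measurable_cst.
  by case: (fb j).
by apply/funext => y; rewrite fE.
Qed.

Lemma moment_ge0 k (x : T) : 0 <= M k.
Proof.
by rewrite -lee_fin -(tM k x); apply: integral_ge0 => y _; rewrite lee_fin exprn_ge0.
Qed.

Lemma potentialE x : (\int[P]_y K x y = \sum_(0 <= k <oo) (a k * M k)%:E)%E.
Proof.
under eq_integral do rewrite KE.
have mt k : measurable_fun setT (fun y => (t x y ^+ k)%:E).
  apply/measurable_EFinP.
  exact: (gram_kernel_measurable x (gram_kernel_exp k t_gram)).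
rewrite integral_nneseries //.
- apply: eq_eseriesr => k _; rewrite EFinM -(tM k x) -ge0_integralZl_EFin //.
  by move=> y _; rewrite lee_fin exprn_ge0.
- by move=> k; under eq_fun do rewrite EFinM; apply: emeasurable_funM.
- by move=> k y _; rewrite lee_fin mulr_ge0 // exprn_ge0.
Qed.

Lemma kernel_ge x y n : ((\sum_(k < n) a k * t x y ^+ k)%:E <= K x y)%E.
Proof.
rewrite KE -sumEFin -(big_mkord xpredT (fun k => (a k * t x y ^+ k)%:E)).
by apply: nneseries_lim_ge => k _ _; rewrite lee_fin mulr_ge0 // exprn_ge0.
Qed.

(** Truncating the power series of K only lowers the energy, as all its terms
    are nonnegative. The truncated kernel is finite on the diagonal, so the
    diagonal can be added and subtracted, and each power is positive definite.
    *)
Lemma discrete_energy_ge N (w : 'I_N -> T) n :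
  ((N%:R ^+ 2 * \sum_(k < n) a k * M k - N%:R * \sum_(k < n) a k)%:E <=
   \sum_(i < N) \sum_(j < N | j != i) K (w i) (w j))%E.
Proof.
pose psi x y := \sum_(k < n) a k * t x y ^+ k.
apply: (@le_trans _ _ (\sum_(i < N) \sum_(j < N | j != i) psi (w i) (w j))%:E); last first.
  rewrite -sumEFin; apply: lee_sum => i _; rewrite -sumEFin; apply: lee_sum => j _.
  exact: kernel_ge.
rewrite lee_fin; apply: (@le_trans _ _
    (\sum_(i < N) \sum_(j < N) psi (w i) (w j) - N%:R * \sum_(k < n) a k)).
  rewrite lerD2r /psi /=.
  under [leRHS]eq_bigr do rewrite exchange_big.
  rewrite [leRHS]exchange_big /= mulr_sumr; apply: ler_sum => k _.
  have := mean_energy_le (gram_kernel_exp k t_gram) (tM k) w.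
  rewrite card_ord => h; rewrite mulrCA.
  under eq_bigr do rewrite -mulr_sumr; rewrite -mulr_sumr.
  by rewrite ler_wpM2l.
under eq_bigr => i _ do rewrite (bigD1 i) //=.
rewrite big_split /= addrAC [X in X - _](_ : _ = N%:R * \sum_(k < n) a k).
  by rewrite subrr add0r.
rewrite mulr_natl -[X in _ *+ X](card_ord N) -sumr_const; apply: eq_bigr => i _.
by rewrite /psi; apply: eq_bigr => k _; rewrite txx expr1n mulr1.
Qed.

Variables (p de A Cm : R).
Hypothesis pde : p < de.
Hypothesis A0 : 0 <= A.
Hypothesis Cm0 : 0 <= Cm.
Hypothesis aA : forall k, (0 < k)%N -> a k <= A * k%:R `^ (p - 1).
Hypothesis MC : forall k, (0 < k)%N -> M k <= Cm * k%:R `^ (- de).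

Let Cst := A * Cm * (2 `^ (de - p + 1) / (de - p)).

(** Replacing the full series by its truncation at n costs the tail of the sum
    of a_k M_k, of order n^(p - de). *)
Lemma series_le n (x0 : T) : (0 < n)%N ->
  (\sum_(0 <= k <oo) (a k * M k)%:E <=
   (\sum_(k < n) a k * M k + Cst * n%:R `^ (p - de))%:E)%E.
Proof.
move=> n0; have aM k : (0 <= (a k * M k)%:E)%E.
  by rewrite lee_fin mulr_ge0 // (moment_ge0 k x0).
apply: lime_le; first by apply: is_cvg_nneseries => k _ _; exact: aM.
near=> m; have nm : (n <= m)%N by near: m; exact: nbhs_infty_ge.
rewrite sumEFin lee_fin (big_cat_nat (n := n)) //= big_mkord lerD2l.
apply: (@le_trans _ _ (\sum_(n <= k < m) A * Cm * k%:R `^ (- (de - p) - 1))).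
  rewrite !big_nat; apply: ler_sum => k /andP[nk _].
  have k0 : (0 < k)%N by exact: leq_trans n0 nk.
  have -> : A * Cm * k%:R `^ (- (de - p) - 1) = (A * k%:R `^ (p - 1)) * (Cm * k%:R `^ (- de)).
    rewrite mulrACA -powRD; last by apply/implyP => _; rewrite pnatr_eq0 -lt0n.
    by congr (_ * _ `^ _); ring.
  by apply: ler_pM; rewrite ?(moment_ge0 k x0) ?aA ?MC.
rewrite -mulr_sumr /Cst -[leRHS]mulrA ler_wpM2l ?mulr_ge0 //.
rewrite -[p - de]opprB; apply: tail_powR_le => //.
by rewrite subr_gt0.
Unshelve. all: by end_near.
Qed.

Lemma energy_ge (x0 : T) : exists C : R, 0 <= C /\ forall N (w : 'I_N -> T) n, (0 < n)%N ->
  ((\int[P]_x \int[P]_y K x y) * (N%:R ^+ 2)%:E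
     - (C * (N%:R ^+ 2 * n%:R `^ (p - de)) + N%:R * \sum_(k < n) a k)%:E <=
   \sum_(i < N) \sum_(j < N | j != i) K (w i) (w j))%E.
Proof.
exists Cst; split.
  by rewrite !mulr_ge0 ?invr_ge0 ?powR_ge0 // subr_ge0 ltW.
move=> N w n n0; apply: le_trans (discrete_energy_ge w n).
under eq_integral do rewrite potentialE.
rewrite (integral_cst_prob P (\sum_(0 <= k <oo) (a k * M k)%:E)%E).
apply: le_trans (leeB (lee_wpmul2r _ (series_le x0 n0)) (lexx _)) _.
  by rewrite lee_fin sqr_ge0.
rewrite -EFinM -EFinB lee_fin.
by rewrite le_eqVlt; apply/orP; left; apply/eqP; ring.
Qed.

End series_kernel.

(** * Laws of overlaps *)
Lemma integral_same_law d (T : measurableType d) (R : realType)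
    (P : probability T R) (h1 h2 : T -> R) (phi : R -> \bar R) :
  measurable_fun setT h1 -> measurable_fun setT h2 ->
  (forall B, measurable B -> P (h1 @^-1` B) = P (h2 @^-1` B)) ->
  measurable_fun setT phi -> (forall r, 0 <= phi r)%E ->
  (\int[P]_x phi (h1 x) = \int[P]_x phi (h2 x))%E.
Proof.
move=> m1 m2 h12 mphi phi0.
have mix1 := isMeasurableFun.Build _ _ _ _ _ m1.
have mix2 := isMeasurableFun.Build _ _ _ _ _ m2.
pose f1 : {mfun T >-> R} := HB.pack h1 mix1.
pose f2 : {mfun T >-> R} := HB.pack h2 mix2.
have e1 := @ge0_integral_pushforward _ _ _ _ R h1 m1 P setT phi measurableT mphi (fun r _ => phi0 r).
have e2 := @ge0_integral_pushforward _ _ _ _ R h2 m2 P setT phi measurableT mphi (fun r _ => phi0 r).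
rewrite preimage_setT in e1 e2.
rewrite -[LHS]e1 -[RHS]e2.
apply: (@eq_measure_integral _ _ _ _ (pushforward P f2) (pushforward P f1)) => B mB _.
exact: h12.
Qed.

Section projective.
Variables (R : realType) (F : scalars) (n : nat).
Hypothesis hO : F = Octonions -> n = 2.
Local Notation K := (cd R (cd_level F)).
Local Notation base := (MkFP (base_pointP R F n)).
Implicit Types x y z : FP R F n.

Lemma continuous_cd_coord m (e : cd_index m) : continuous (fun u : cd R m => cd_coord u e).
Proof.
elim: m e => [|m IH] e; first by move=> u; exact: cvg_id.
case: e => e u.
  exact: (cvg_comp (fun v : cd R m.+1 => v.1) (fun v => cd_coord v e) cvg_fst (IH e u.1)).
exact: (cvg_comp (fun v : cd R m.+1 => v.2) (fun v => cd_coord v e) cvg_snd (IH e u.2)).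
Qed.

Lemma continuous_entry m k (i : 'I_m) (j : 'I_k) (T : topologicalType) :
  continuous (fun M : 'M[T]_(m, k) => M i j).
Proof.
move=> M A nA; exists (fun i' j' => if (i' == i) && (j' == j) then A else setT).
  move=> i' j'; case: ifPn => [/andP[/eqP -> /eqP ->]//|_]; exact: filterT.
by move=> M' /(_ i j); rewrite !eqxx.
Qed.

Lemma open_FP_measurable (A : set (FP R F n)) : open A -> measurable A.
Proof. by move=> oA; exact: sub_sigma_algebra. Qed.

Lemma continuous_FP_measurable (f : FP R F n -> R) : continuous f -> measurable_fun setT f.
Proof.
move=> /continuousP cf.
apply: (measurability _ (RGenOpens.measurableE R)).
move=> _ [_ [a [b ->] <-]].
rewrite setTI; apply: open_FP_measurable; apply: cf; exact: interval_open.
Qed.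

Lemma inner_base x : mx_inner x base = cd_Re (x ord0 ord0).
Proof.
rewrite mx_innerE /cd_dotmx (bigD1 ord0) //= [X in _ + X]big1 ?addr0 => [|i i0]; last first.
  by apply: big1 => j _; rewrite mxE (negbTE i0) /= /cd_dot cd_conj0 cd_mul0r cd_Re0.
rewrite (bigD1 ord0) //= [X in _ + X]big1 ?addr0 => [|j j0]; last first.
  by rewrite mxE (negbTE j0) /= /cd_dot cd_conj0 cd_mul0r cd_Re0.
by rewrite mxE /= /cd_dot cd_conj1 cd_mul1r.
Qed.

(** By transitivity one of the two points may be taken to be the base point,
    and the overlap is then a diagonal entry of the other one. Over the
    octonions this is not visible from the formula for the inner product. *)
Lemma inner_ge0 x y : 0 <= mx_inner x y.
Proof.
have [f [_ fI fy]] := FP_transitive y hO.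
by rewrite -fI fy inner_base FP_diag_ge0.
Qed.

End projective.

(** * Moments of overlaps *)
Section lattice_sums.
Variable R : realType.

Definition nat_dist (a b : nat) : nat := (a - b) + (b - a).

Lemma sum_expr_ndist_le (r : R) (m a : nat) : 0 <= r < 1 ->
  \sum_(b < m) r ^+ nat_dist a b <= 2 * (1 - r)^-1.
Proof.
move=> r01; have [r0 r1] := andP r01.
(* Removing one site at the left end shifts a and m together. *)
have H : \sum_(b < m) r ^+ nat_dist a b <= \sum_(k < a.+1) r ^+ k + \sum_(k < m) r ^+ k.
  elim: a m => [|a IH] [|m].
  - by rewrite !big_ord0 addr0; apply: sumr_ge0 => k _; exact: exprn_ge0.
  - rewrite -[leLHS]add0r lerD //; first by apply: sumr_ge0 => k _; exact: exprn_ge0.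
    by apply: ler_sum => b _; rewrite /nat_dist sub0n subn0.
  - by rewrite !big_ord0 addr0; apply: sumr_ge0 => k _; exact: exprn_ge0.
  - rewrite big_ord_recl /= [X in _ + X <= _](_ : _ = \sum_(b < m) r ^+ nat_dist a b) //.
    rewrite big_ord_recr /= [X in _ <= _ + X]big_ord_recr /= /nat_dist subn0 sub0n addn0.
    by have := IH m; have := exprn_ge0 m r0; rewrite /nat_dist; lra.
rewrite mulr_natl mulr2n; apply: le_trans H _.
by apply: lerD; exact: geometric_sum_le.
Qed.

Lemma nat_sqrt_bounds k : exists m, (m ^ 2 <= k < m.+1 ^ 2)%N.
Proof.
have h : exists m, (m ^ 2 <= k)%N by exists 0%N.
have b m : (m ^ 2 <= k)%N -> (m <= k)%N.
  by apply: leq_trans; case: m => // m; rewrite expnS expn1 leq_pmulr.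
case: (ex_maxnP h b) => m mk mmax; exists m; rewrite mk ltnNge /=.
by apply/negP => /mmax; rewrite ltnn.
Qed.

End lattice_sums.

Section moments.
Variables (R : realType) (F : scalars) (n : nat).
Hypothesis hO : F = Octonions -> n = 2.
Variable sigma : probability (FP R F n) R.
Hypothesis hsigma : isometry_invariant sigma.
Local Notation base := (MkFP (base_pointP R F n)).
Implicit Types x y z : FP R F n.

Lemma continuous_FP_coord i j (e : cd_index (cd_level F)) :
  continuous (fun x : FP R F n => cd_coord (x i j) e).
Proof.
move=> x.
have c1 := @initial_continuous _ _ (@FP_mx R F n) x.
have c2 := @continuous_entry n.+1 n.+1 i j (cd R (cd_level F)) (FP_mx x).
have c3 := @continuous_cd_coord R (cd_level F) e (FP_mx x i j).
exact: (cvg_comp _ _ (cvg_comp _ _ c1 c2) c3).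
Qed.

Lemma FP_coord_le1 x i j (e : cd_index (cd_level F)) : `|cd_coord (x i j) e| <= 1.
Proof.
rewrite -ler_sqr ?nnegrE // expr1n real_normK ?num_real //.
rewrite -(inner_xx x) mx_innerE /cd_dotmx (bigD1 i) //= (bigD1 j) //= cd_dotE (bigD1 e) //=.
rewrite -expr2 -!addrA lerDl !addr_ge0 //.
- by apply: sumr_ge0 => e' _; rewrite -expr2 sqr_ge0.
- by apply: sumr_ge0 => j' _; exact: cd_dot_ge0.
- by apply: sumr_ge0 => i' _; apply: sumr_ge0 => j' _; exact: cd_dot_ge0.
Qed.

Lemma inner_gram : gram_kernel (fun x y : FP R F n => mx_inner x y).
Proof.
exists ('I_n.+1 * 'I_n.+1 * cd_index (cd_level F))%type.
exists (fun ije x => cd_coord (x ije.1.1 ije.1.2) ije.2); split => [[[i j] e]|x y] /=.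
  split; last by exists 1 => x; exact: FP_coord_le1.
  by apply: continuous_FP_measurable; exact: continuous_FP_coord.
rewrite mx_innerE /cd_dotmx pair_big /=.
under eq_bigr do rewrite cd_dotE.
by rewrite pair_big.
Qed.

Lemma inner_measurable x : measurable_fun setT (fun y : FP R F n => mx_inner x y).
Proof. exact: (gram_kernel_measurable x inner_gram). Qed.

Definition moment k : R := fine (\int[sigma]_y (mx_inner base y ^+ k)%:E)%E.

Lemma isometry_congruent (f : FP R F n -> FP R F n) :
  bijective f -> (forall u v, mx_inner (f u) (f v) = mx_inner u v) -> is_isometry f.
Proof. by move=> bf fI; split => // x y; rewrite /geodesic /chordal fI. Qed.

(** The law of the overlap with x does not depend on x, since isometries act
    transitively and preserve sigma. *)
Lemma momentE k x : (\int[sigma]_y (mx_inner x y ^+ k)%:E = (moment k)%:E)%E.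
Proof.
have bm y : bounded_mfun (fun z : FP R F n => mx_inner y z ^+ k).
  split; first by apply: measurable_funX; exact: inner_measurable.
  exists 1 => z; rewrite ger0_norm ?exprn_ge0 ?inner_ge0 //.
  by rewrite exprn_ile1 ?inner_ge0 ?inner_le1.
rewrite /moment fineK; last first.
  by apply: integrable_fin_num => //; exact: (bounded_mfun_integrable sigma (bm base)).
have [f [bf fI fx]] := FP_transitive x hO.
pose phi (r : R) := (`|r| ^+ k)%:E.
have E y : (\int[sigma]_z (mx_inner y z ^+ k)%:E = \int[sigma]_z phi (mx_inner y z))%E.
  by apply: eq_integral => z _; rewrite /phi ger0_norm // inner_ge0.
rewrite !E; apply: integral_same_law.
- exact: inner_measurable.
- exact: inner_measurable.
- move=> B mB; rewrite -fx.
  have mA : measurable ((fun y => mx_inner (f x) y) @^-1` B).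
    by rewrite -[X in measurable X]setTI; apply: inner_measurable.
  rewrite -(hsigma (isometry_congruent bf fI) mA); congr (sigma _).
  by apply/seteqP; split => y /=; rewrite fI.
- apply/measurable_EFinP; apply: measurable_funX; exact: normr_measurable.
- by move=> r; rewrite lee_fin exprn_ge0.
Qed.

Let E : finType := ('I_n * cd_index (cd_level F))%type.
Let D := dim_FP F n.

Lemma card_E : #|E| = D. Proof. exact: dim_FPE. Qed.

Definition lattice_point m (f : {ffun E -> 'I_m}) : FP R F n :=
  chart hO (fun j => cd_of_coord (fun e => (f (j, e))%:R / m%:R)).

Let c : R := (4 * (1 + D%:R) ^+ 3)^-1.

Let c0 : 0 < c.
Proof. by rewrite invr_gt0 mulr_gt0 // exprn_gt0 // ltr_pwDl. Qed.

Lemma lattice_separation m (f g : {ffun E -> 'I_m}) : (0 < m)%N ->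
  mx_inner (lattice_point f) (lattice_point g) <=
  1 - c * \sum_e (((f e)%:R - (g e)%:R) / m%:R) ^+ 2.
Proof.
move=> m0; have m0' : (0 : R) < m%:R by rewrite ltr0n.
have sq (h : {ffun E -> 'I_m}) :
    sqnorm (fun j => cd_of_coord (fun e => (h (j, e))%:R / m%:R) : cd R (cd_level F)) <= D%:R.
  rewrite /sqnorm; under eq_bigr do rewrite cd_dotE.
  rewrite pair_big /= -card_E -sum1_card natr_sum; apply: ler_sum => -[j e] _ /=.
  rewrite cd_of_coordK -expr2 exprn_ile1 ?divr_ge0 ?ler0n //.
  by rewrite ler_pdivrMr // mul1r ler_nat ltnW.
apply: le_trans (chart_separation hO (sq f) (sq g)) _.
rewrite lerD2l lerN2 ler_wpM2l ?(ltW c0) //.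
rewrite /sqnorm; under [leRHS]eq_bigr do rewrite cd_dotE.
rewrite pair_big /=; apply: ler_sum => -[j e] _ /=.
by rewrite !cd_coordB !cd_of_coordK -mulrBl expr2.
Qed.

(** As m^2 <= k, the factor k absorbs the mesh size, and squares of integers
    dominate the integers themselves. *)
Lemma lattice_inner_exp_le m k (f g : {ffun E -> 'I_m}) : (0 < m)%N -> (m ^ 2 <= k)%N ->
  mx_inner (lattice_point f) (lattice_point g) ^+ k <=
  \prod_e expR (- c) ^+ nat_dist (f e) (g e).
Proof.
move=> m0 mk; have m0' : (0 : R) < m%:R by rewrite ltr0n.
pose S : R := \sum_e (((f e)%:R - (g e)%:R) / m%:R) ^+ 2.
have h1 : mx_inner (lattice_point f) (lattice_point g) <= expR (- (c * S)).
  by apply: le_trans (lattice_separation f g m0) _; exact: expR_ge1Dx.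
apply: (@le_trans _ _ (expR (- (c * S)) ^+ k)).
  by rewrite lerXn2r ?nnegrE ?inner_ge0 ?expR_ge0.
rewrite -expRM_natl.
under eq_bigr do rewrite -expRM_natl.
rewrite -expR_sum ler_expR -mulr_suml mulrN (mulrC (\sum_e _)) mulNr lerN2 mulrCA.
rewrite ler_pM2l // /S mulr_sumr; apply: ler_sum => e _.
rewrite expr_div_n mulrA ler_pdivlMr ?exprn_gt0 // mulrC.
apply: ler_pM; rewrite ?ler0n ?exprn_ge0 ?(ltW m0') //.
  by rewrite -natrX ler_nat.
move: (val (f e)) (val (g e)) => a b.
have -> : (a%:R - b%:R : R) ^+ 2 = (nat_dist a b)%:R ^+ 2.
  rewrite /nat_dist natrD; have [ab|/ltnW ba] := leqP a b.
    by rewrite (eqP (ab : a - b == 0)%N) add0r natrB // -sqrrN opprB.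
  by rewrite (eqP (ba : b - a == 0)%N) addr0 natrB.
by rewrite -natrX ler_nat; case: (nat_dist a b) => // l; rewrite expnS expn1 leq_pmulr.
Qed.

(** Apply the energy inequality for the k-th power of the overlap to m^D
    lattice points of the chart, where m is about the square root of k. The
    powers decay geometrically in the lattice distance, in each coordinate
    separately, so the double sum factorizes and is at most (B m)^D; dividing
    by the square of the number of points gives (B / m)^D. *)
Lemma moment_le : exists2 C : R, 0 <= C &
  forall k, (0 < k)%N -> moment k <= C * k%:R `^ (- (D%:R / 2)).
Proof.
pose r := expR (- c).
have r01 : 0 <= r < 1 by rewrite expR_ge0 expR_lt1 oppr_lt0.
pose B := 2 * (1 - r)^-1.
have B0 : 0 <= B by rewrite mulr_ge0 // invr_ge0 subr_ge0; case/andP: r01 => _ /ltW.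
exists ((2 * B) ^+ D) => [|k k0]; first by rewrite exprn_ge0 // mulr_ge0.
have [m /andP[mk km]] := nat_sqrt_bounds k.
have m0 : (0 < m)%N by case: m mk km => //; case: (k) k0.
have m0' : (0 : R) < m%:R by rewrite ltr0n.
have k0' : (0 : R) < k%:R by rewrite ltr0n.
have h := mean_energy_le (gram_kernel_exp k inner_gram) (momentE k) (@lattice_point m).
have {h} : (m ^ D)%:R ^+ 2 * moment k <= (m ^ D)%:R * B ^+ D.
  have mD : #|{ffun E -> 'I_m}| = (m ^ D)%N by rewrite card_ffun card_ord card_E.
  rewrite mD in h; apply: le_trans h _; rewrite mulr_natl -mD -sumr_const.
  apply: ler_sum => f _.
  apply: (@le_trans _ _ (\sum_(g : {ffun E -> 'I_m}) \prod_e r ^+ nat_dist (f e) (g e))).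
    by apply: ler_sum => g _; exact: lattice_inner_exp_le.
  rewrite -(bigA_distr_bigA (fun e (b : 'I_m) => r ^+ nat_dist (f e) b)) -card_E -prodr_const.
  apply: ler_prod => e _; rewrite sum_expr_ndist_le // andbT.
  by apply: sumr_ge0 => b _; rewrite exprn_ge0 //; case/andP: r01.
rewrite natrX expr2 -mulrA ler_pM2l ?exprn_gt0 // mulrC -ler_pdivlMr ?exprn_gt0 //.
move=> /le_trans; apply; rewrite (_ : (2 * B) ^+ D = 2 ^+ D * B ^+ D); last exact: exprMn.
rewrite [leRHS]mulrAC [leRHS]mulrC ler_wpM2l ?exprn_ge0 //.
have -> : k%:R `^ (- (D%:R / 2)) = ((Num.sqrt k%:R)^-1) ^+ D :> R.
  rewrite -powR12_sqrt ?(ltW k0') // -powRN -powR_mulrn ?powR_ge0 // -powRrM.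
  by congr (_ `^ _); ring.
rewrite -exprVn -exprMn lerXn2r ?nnegrE ?mulr_ge0 ?invr_ge0 ?sqrtr_ge0 ?(ltW m0') //.
have s0 : (0 : R) < Num.sqrt k%:R by rewrite sqrtr_gt0.
rewrite ler_pdivlMr // mulrC ler_pdivrMr //.
rewrite -ler_sqr ?nnegrE ?mulr_ge0 ?sqrtr_ge0 ?(ltW m0') //.
rewrite sqr_sqrtr ?(ltW k0') // -natrM -natrX ler_nat.
apply: leq_trans (ltnW km) _; rewrite leq_exp2r //; lia.
Qed.

End moments.

(** * The Riesz and logarithmic kernels *)
Section nonnegative_series.
Variables (R : realType) (u : nat -> R).

Lemma nneseries_cvg (l : R) : (fun n => \sum_(k < n) u k) @ \oo --> l ->
  (\sum_(0 <= k <oo) (u k)%:E)%E = l%:E.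
Proof.
move=> ul; apply: cvg_lim => //.
rewrite (_ : (fun n => _) = EFin \o (fun n => \sum_(k < n) u k)).
  by apply: cvg_EFin => //; exact: nearW.
by apply/funext => n /=; rewrite sumEFin big_mkord.
Qed.

Lemma nneseries_harmonic (c : R) : (forall k, 0 <= u k) -> 0 < c ->
  (forall k, (0 < k)%N -> c / k%:R <= u k) ->
  (\sum_(0 <= k <oo) (u k)%:E)%E = +oo%E.
Proof.
move=> u0 c0 cu; set S := (\sum_(0 <= k <oo) _)%E.
have part n : ((\sum_(k < n) u k)%:E <= S)%E.
  rewrite -sumEFin -(big_mkord xpredT (fun k => (u k)%:E)).
  by apply: nneseries_lim_ge => k _ _; rewrite lee_fin.
case ES : S => [r| |] //; last by have := part 0%N; rewrite ES.
exfalso; apply: (@dvg_harmonic R); apply: nondecreasing_is_cvgn.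
  by apply: nondecreasing_series => k _ _; exact: harmonic_ge0.
exists (r / c) => _ [n _ <-]; rewrite /series /= ler_pdivlMr // mulr_suml big_mkord.
have := part n.+1; rewrite ES lee_fin; apply: le_trans.
rewrite big_ord_recl -[leLHS]add0r lerD // ?u0 //; apply: ler_sum => k _.
by rewrite /harmonic /= mulrC; exact: cu.
Qed.

End nonnegative_series.

Section kernels.
Variables (R : realType) (F : scalars) (n : nat).
Hypothesis hO : F = Octonions -> n = 2.
Implicit Types x y : FP R F n.

Lemma inner_lt1 x y : mx_inner x y != 1 -> 0 <= mx_inner x y < 1.
Proof. by move=> t1; rewrite inner_ge0 // lt_neqAle t1 inner_le1. Qed.

Lemma chordal_gt0 x y : mx_inner x y != 1 -> 0 < chordal x y.
Proof. by move=> /inner_lt1/andP[_ t1]; rewrite sqrtr_gt0 subr_gt0. Qed.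

Lemma chordal_eq0 x y : mx_inner x y = 1 -> chordal x y = 0.
Proof. by rewrite /chordal => ->; rewrite subrr sqrtr0. Qed.

(** At coinciding points both sides are infinite, as the coefficients dominate
    the harmonic series. *)
Lemma riesz_series (s : R) x y : 0 < s ->
  riesz s x y = (\sum_(0 <= k <oo) (riesz_coef (s / 2) k * mx_inner x y ^+ k)%:E)%E.
Proof.
move=> s0; have p0 : 0 < s / 2 by rewrite divr_gt0.
rewrite /riesz; have [t1|t1] := eqVneq (mx_inner x y) 1.
  rewrite (chordal_eq0 t1) eqxx; apply/esym; apply: (@nneseries_harmonic _ _ (s / 2)) => //.
    by move=> k; rewrite t1 expr1n mulr1 riesz_coef_ge0.
  by move=> k k0; rewrite t1 expr1n mulr1 riesz_coef_ge.
rewrite gt_eqF ?chordal_gt0 //; apply/esym; apply: nneseries_cvg.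
have t01 := inner_lt1 t1.
have -> : chordal x y `^ (- s) = (1 - mx_inner x y) `^ (- (s / 2)).
  rewrite /chordal -powR12_sqrt; last by rewrite subr_ge0 inner_le1.
  by rewrite -powRrM; congr (_ `^ _); ring.
exact: riesz_psum_cvg.
Qed.

Lemma log_series x y :
  log_kernel x y = (\sum_(0 <= k <oo) (log_coef R k * mx_inner x y ^+ k)%:E)%E.
Proof.
rewrite /log_kernel; have [t1|t1] := eqVneq (mx_inner x y) 1.
  rewrite (chordal_eq0 t1) le0_lneNy //; apply/esym.
  apply: (@nneseries_harmonic _ _ 2^-1) => //.
    by move=> k; rewrite t1 expr1n mulr1 log_coef_ge0.
  by move=> k k0; rewrite t1 expr1n mulr1 /log_coef invfM.
rewrite lne_EFin ?chordal_gt0 //; apply/esym; apply: nneseries_cvg.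
have t01 := inner_lt1 t1.
rewrite /chordal -powR12_sqrt; last by rewrite subr_ge0 inner_le1.
rewrite ln_powR; exact: log_psum_cvg.
Qed.

End kernels.

Section truncation_level.
Variable R : realType.

Lemma nat_between (x : R) : 1 <= x -> exists2 T, (0 < T)%N & x <= T%:R <= 2 * x.
Proof.
move=> x1; have x0 : 0 <= x by apply: le_trans x1.
exists (Num.truncn x).+1 => //; have /andP[h1 h2] := truncn_itv x0.
rewrite (ltW h2) -natr1 /=; lra.
Qed.

End truncation_level.

Theorem theorem4p12 (R : realType) (F : scalars) (d : nat)
    (hd : (3 <= d)%N) (hO : F = Octonions -> d = 3%N)
    (sigma : probability (FP R F d.-1) R) (hsigma : isometry_invariant sigma) :
  let D : R := (dim_FP F d.-1)%:R in
  (forall s : R, 0 < s -> s < D ->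
    exists C : R, 0 < C /\
      forall (N : nat) (w : 'I_N -> FP R F d.-1),
        (energy_integral sigma (riesz s) * (N%:R ^+ 2)%:E
           - (C * N%:R `^ (1 + s / D))%:E
         <= discrete_energy (riesz s) w)%E) /\
  (exists C : R, 0 < C /\
    forall (N : nat) (w : 'I_N -> FP R F d.-1),
      (energy_integral sigma log_kernel * (N%:R ^+ 2)%:E
         - (D^-1 * N%:R * ln N%:R)%:E - (C * N%:R)%:E
       <= discrete_energy log_kernel w)%E).
Proof.
move=> D; have hO' : F = Octonions -> d.-1 = 2%N by move/hO => ->.
have D0 : 0 < D.
  rewrite ltr0n /dim_FP muln_gt0; apply/andP; split; last by case: (F).
  by move: hd; case: (d) => [|[]].
have [Cm Cm0 momC] := moment_le hO' hsigma.
have gen := fun a K a0 KE p A pD A0 aA => @energy_ge _ _ _ sigma _ _ (inner_gram R F d.-1)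
  (inner_ge0 hO') (@inner_xx _ _ _) (momentE hO' hsigma) a K a0 KE p (D / 2) A Cm pD A0 Cm0 aA momC
  (MkFP (base_pointP R F d.-1)).
(* The truncation level N^(2 / D) balances the tail of the series against the
   diagonal terms. *)
have pick N : (0 < N)%N -> exists2 T, (0 < T)%N &
    N%:R `^ (2 / D) <= (T%:R : R) <= 2 * N%:R `^ (2 / D).
  move=> N0; apply: nat_between.
  apply: (@le_trans _ _ ((N%:R : R) `^ 0)); first by rewrite powRr0.
  by apply: ler_powR; rewrite ?ler1n // divr_ge0 // ltW.
have decay N T (q : R) : (0 < N)%N -> N%:R `^ (2 / D) <= T%:R :> R -> q < D / 2 ->
    N%:R ^+ 2 * T%:R `^ (q - D / 2) <= N%:R `^ (1 + 2 * q / D) :> R.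
  move=> N0 NT qD; have N0' : (0 : R) < N%:R by rewrite ltr0n.
  have -> : 1 + 2 * q / D = 2%:R + (2 / D) * (q - D / 2) by field; rewrite gt_eqF.
  rewrite [leRHS]powRD; last by apply/implyP => _; rewrite gt_eqF.
  rewrite powR_mulrn ?(ltW N0') // ler_wpM2l ?exprn_ge0 // powRrM.
  have y0 : 0 < N%:R `^ (2 / D) by rewrite powR_gt0.
  have T0' : (0 : R) < T%:R by exact: lt_le_trans y0 NT.
  rewrite -[q - D / 2]opprB !powRN lef_pV2 ?posrE ?powR_gt0 //.
  by rewrite ge0_ler_powR ?nnegrE ?subr_ge0 ?(ltW qD) ?powR_ge0 ?ler0n.
split=> [s s0 sD|].
- have p0 : 0 < s / 2 by rewrite divr_gt0.
  have pD : s / 2 < D / 2 by rewrite ltr_pM2r.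
  have A0 : 0 <= s / 2 * (2 * 2 `^ (s / 2)) by rewrite !mulr_ge0 ?powR_ge0 // ltW.
  have [C [C0 CE]] := gen _ _ (riesz_coef_ge0 p0) (fun x y => riesz_series hO' x y s0) _ _ pD A0
    (riesz_coef_le p0).
  pose B : R := 2 * 2 `^ (s / 2) * 2 `^ (s / 2).
  have B0 : 0 <= B by rewrite !mulr_ge0 ?powR_ge0.
  exists (C + B + 1); split; first by rewrite ltr_pwDr // addr_ge0.
  move=> N w; have [N0|N0] := posnP N.
    subst N; rewrite expr0n /= mule0 powR0 ?mulr0 ?sube0 /discrete_energy ?big_ord0 //.
    by rewrite gt_eqF // addr_gt0 // divr_gt0.
  have N0' : (0 : R) < N%:R by rewrite ltr0n.
  have [T T0 /andP[NT TN]] := pick N N0.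
  apply: le_trans (CE N w T T0); apply: leeB => //; rewrite lee_fin.
  rewrite -addrA mulrDl; apply: lerD.
    rewrite ler_wpM2l //; have := decay N T (s / 2) N0 NT pD.
    by rewrite mulrCA divff ?mulr1.
  have -> : N%:R `^ (1 + s / D) = N%:R * N%:R `^ (s / D) :> R.
    by rewrite powRD ?powRr1 ?(ltW N0') //; apply/implyP => _; rewrite gt_eqF.
  rewrite mulrCA ler_wpM2l ?(ltW N0') //; apply: le_trans (sum_riesz_coef_le p0 T0) _.
  apply: (@le_trans _ _ (B * N%:R `^ (s / D))); last by rewrite ler_wpM2r ?powR_ge0 // lerDl.
  rewrite /B -!mulrA; do 2 rewrite ler_wpM2l ?powR_ge0 //.
  apply: (@le_trans _ _ ((2 * N%:R `^ (2 / D)) `^ (s / 2))).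
    by rewrite ge0_ler_powR ?nnegrE ?(ltW p0) ?mulr_ge0 ?powR_ge0 ?ler0n.
  rewrite powRM ?powR_ge0 // -powRrM (_ : 2 / D * (s / 2) = s / D) //.
  by field; rewrite gt_eqF.
- have A0 : 0 <= 2^-1 :> R by [].
  have pD : 0 < D / 2 by rewrite divr_gt0.
  have aA k : (0 < k)%N -> log_coef R k <= 2^-1 * k%:R `^ (0 - 1).
    by move=> k0; rewrite sub0r powR_inv1 // /log_coef invfM.
  have [C [C0 CE]] := gen _ _ (@log_coef_ge0 R) (log_series hO') _ _ pD A0 aA.
  pose B : R := 2^-1 * (1 + ln 2).
  have B0 : 0 <= B by rewrite mulr_ge0 // addr_ge0 // ln_ge0 // ler1n.
  exists (C + B + 1); split; first by rewrite ltr_pwDr // addr_ge0.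
  move=> N w; have [N0|N0] := posnP N.
    by subst N; rewrite expr0n /= mule0 !mulr0 mul0r !sube0 /discrete_energy big_ord0.
  have N0' : (0 : R) < N%:R by rewrite ltr0n.
  have [T T0 /andP[NT TN]] := pick N N0.
  apply: le_trans (CE N w T T0); rewrite -addeA -oppeD // -EFinD; apply: leeB => //.
  rewrite lee_fin.
  have h1 : C * (N%:R ^+ 2 * T%:R `^ (0 - D / 2)) <= C * N%:R.
    rewrite ler_wpM2l //; have := decay N T 0 N0 NT pD.
    by rewrite mulr0 mul0r addr0 powRr1 // ltW.
  have h2 : \sum_(k < T) log_coef R k <= B + D^-1 * ln N%:R.
    apply: le_trans (sum_log_coef_le R T0) _.
    have : ln (T%:R : R) <= ln (2 * N%:R `^ (2 / D)).
      by rewrite ler_ln ?posrE ?ltr0n ?mulr_gt0 ?powR_gt0.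
    rewrite lnM ?posrE ?powR_gt0 // ln_powR => h.
    have -> : B + D^-1 * ln N%:R = 2^-1 * (1 + (ln 2 + 2 / D * ln N%:R)).
      by rewrite /B; field; rewrite gt_eqF.
    by rewrite ler_wpM2l // lerD2l.
  have h3 := ler_wpM2l (ltW N0') h2.
  apply: le_trans (lerD h1 h3) _; rewrite -subr_ge0.
  by rewrite (_ : _ - _ = N%:R) ?ler0n //; ring.
Qed.
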